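(* Let $u_0\in W^{1,\infty}(\mathbb{R}^d)$. Assume that $H$ satisfies $(\mathbf{H}_1)$, $(\mathbf{H}_2')$, $(\mathbf{H}_3)$ and $(\mathbf{H}_4)$ (listed in the context). Then $u^n$ is well defined over $Q_h=\mathbb{R}^d\times\{0,\dots,N\}$ by $u^0=u_0$ and $$u^{n+1}(x)=\inf_{\xi\in\mathbb{R}^d}\{u^n(x-\xi h)+h\,H^*(x,t^n,\xi)\},\quad x\in\mathbb{R}^d,$$ i.e. the set $A^n(x)$ of arguments $\xi$ realizing this infimum is a non-empty set, bounded in $\mathbb{R}^d$ uniformly in $(x,n)\in Q_h$, and the infimum is a minimum. Moreover, $u^n\in W^{1,\infty}(\mathbb{R}^d)$ with $\|u^n\|_{W^{1,\infty}(\mathbb{R}^d)}$ bounded uniformly in $n$; and, assuming in addition $H^*\in L^\infty(Q_T\times\overline B(0,K))$ when the growth condition $(\mathbf{H}_4)$-(i) is the one satisfied, $u^n$ is Lipschitz continuous with respect to $n$ uniformly in $x$. That is, there exist three positive constants $C_0,C_1,C_2$ independent of $h$ and $n$ such that $$\|u^n\|_{L^\infty(\mathbb{R}^d)}\le C_0,\qquad\|\nabla u^n\|_{L^\infty(\mathbb{R}^d)}\le C_1,\qquad |u^n(x)-u^m(x)|\le C_2|n-m|\,h,$$ for all $n,m=0,\dots,N$ and $x\in\mathbb{R}^d$.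
   Context: $d\ge1$, $T>0$, $Q_T=\mathbb{R}^d\times[0,T]$, $H:Q_T\times\mathbb{R}^d\to\mathbb{R}$, $(x,t,p)\mapsto H(x,t,p)$. For $N\in\mathbb{N}$, $h=T/N$ and $t^n=nh$, $n=0,\dots,N$. $H^*(x,t,\xi)=\sup_{p\in\mathbb{R}^d}\{\xi\cdot p-H(x,t,p)\}\in\mathbb{R}\cup\{+\infty\}$ is the Legendre transform in $p$. $B(0,R)$ is the ball of radius $R$ centered at $0$. Assumptions: $(\mathbf{H}_1)$ $H$ is uniformly continuous on $Q_T\times B(0,R)$ for any $R>0$. $(\mathbf{H}_2')$ For any $R>0$, $\sup_{Q_T\times\overline B(0,R)}|H(x,t,p)|<+\infty$. $(\mathbf{H}_3)$ There is $\eta>0$ with $|H(x,t,p)-H(y,t,p)|\le\eta(1+|p|)|x-y|$ for all $t\in[0,T]$, $x,y,p\in\mathbb{R}^d$. $(\mathbf{H}_4)$ $H$ is convex in $p$ and satisfies one of: (i) there is $K>0$ with $\lim_{|p|\to\infty}H(x,t,p)/|p|=K$ uniformly in $(x,t)\in Q_T$, and there is a positive function $\alpha\in L^\infty(\mathbb{R}^d)$ with $|H(x,t,p)-H(y,t,p)|\le\alpha(p)|x-y|$ uniformly on $Q_T\times\mathbb{R}^d$; (ii) $\lim_{|p|\to\infty}\inf_{(x,t)\in Q_T}H(x,t,p)/|p|=+\infty$. *)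

(* Defs.v *)
From HB Require Import structures.
From mathcomp Require Import all_boot all_order all_algebra.
From mathcomp Require Import all_classical all_reals all_analysis measurable_realfun.
Set Implicit Arguments.
Unset Strict Implicit.
Unset Printing Implicit Defensive.
Import Order.TTheory GRing.Theory Num.Theory.
Import numFieldNormedType.Exports.
Local Open Scope classical_set_scope.
Local Open Scope ring_scope.

(* The norm of the library on 'rV[R]_d is the sup norm; the topology is the
   same, but balls and |p| in the growth conditions are Euclidean. *)
Definition dot (R : realType) (d : nat) (x y : 'rV[R]_d) : R :=
  \sum_(i < d) x 0 i * y 0 i.

Definition enorm (R : realType) (d : nat) (x : 'rV[R]_d) : R :=
  Num.sqrt (dot x x).

(* d-dimensional Lebesgue measure, carried by d.-tuple R with its product
   sigma-algebra: the image of lebesgue_measure \x (d-1 dimensional measure)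
   under (x, y) |-> x :: y. *)
Section lebesgue_tuple.
Context (R : realType).
Local Notation Rm := (measurableTypeR R).

Definition cons_tup (n : nat) (p : Rm * n.-tuple Rm) : n.+1.-tuple Rm :=
  [the n.+1.-tuple Rm of p.1 :: p.2].

Lemma measurable_cons_tup (n : nat) : measurable_fun setT (@cons_tup n).
Proof.
exact: (measurable_cons measurable_fst measurable_snd).
Qed.

Section step.
Context (n : nat) (mu : {sigma_finite_measure set (n.-tuple Rm) -> \bar R}).

Definition lebesgue_step : set (n.+1.-tuple Rm) -> \bar R :=
  pushforward (@lebesgue_measure R \x mu)%E (@cons_tup n).

Let lebesgue_step0 : lebesgue_step set0 = 0%E.
Proof. by rewrite /lebesgue_step /pushforward preimage_set0 measure0. Qed.

Let lebesgue_step_ge0 A : (0 <= lebesgue_step A)%E.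
Proof. by rewrite /lebesgue_step /pushforward measure_ge0. Qed.

Let lebesgue_step_sigma_additive : semi_sigma_additive lebesgue_step.
Proof.
move=> F mF tF mUF; rewrite /lebesgue_step /pushforward preimage_bigcup.
apply: measure_semi_sigma_additive.
- move=> k; rewrite -[X in measurable X]setTI.
  exact: (measurable_cons_tup measurableT (mF k)).
- apply/trivIsetP => /= i j _ _ ij; rewrite -preimage_setI.
  by move/trivIsetP : tF => /(_ _ _ _ _ ij) ->//; rewrite preimage_set0.
- rewrite -preimage_bigcup -[X in measurable X]setTI.
  exact: (measurable_cons_tup measurableT mUF).
Qed.

HB.instance Definition _ := isMeasure.Build _ _ _ lebesgue_step
  lebesgue_step0 lebesgue_step_ge0 lebesgue_step_sigma_additive.

Let lebesgue_step_sigma_finite : sigma_finite setT lebesgue_step.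
Proof.
have /sigma_finiteP[F [TF ndF Foo]] := sigma_finiteT (@lebesgue_measure R).
have /sigma_finiteP[G [TG ndG Goo]] := sigma_finiteT mu.
pose u (w : n.+1.-tuple Rm) : Rm * n.-tuple Rm := (thead w, [tuple of behead w]).
have mu_ : measurable_fun setT u.
  by apply: measurable_fun_pair; [exact: measurable_tnth|exact: measurable_behead].
have uK : cancel (@cons_tup n) u.
  by move=> [a b]; rewrite /u /=; congr pair; apply/val_inj.
exists (fun k => u @^-1` (F k `*` G k)).
  apply/esym; rewrite -subTset => w _.
  have [k _ Fk] : (\bigcup_i F i) (u w).1 by rewrite -TF.
  have [l _ Gl] : (\bigcup_i G i) (u w).2 by rewrite -TG.
  exists (maxn k l) => //; split.
  - by move: Fk; exact/subsetPset/ndF/leq_maxl.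
  - by move: Gl; exact/subsetPset/ndG/leq_maxr.
move=> k; have [mFk Fkoo] := Foo k; have [mGk Gkoo] := Goo k; split.
  by rewrite -[X in measurable X]setTI; apply: mu_ => //; exact: measurableX.
rewrite /lebesgue_step /pushforward -comp_preimage.
have -> : u \o @cons_tup n = id by apply/funext => p; exact: uK.
rewrite preimage_id.
by rewrite product_measure1E// lte_mul_pinfty// ge0_fin_numE.
Qed.

HB.instance Definition _ := Measure_isSigmaFinite.Build _ _ _ lebesgue_step
  lebesgue_step_sigma_finite.

End step.

Fixpoint lebesgue_tuple (n : nat) :
    {sigma_finite_measure set (n.-tuple Rm) -> \bar R} :=
  match n with
  | 0 => dirac [tuple]
  | n'.+1 => lebesgue_step (lebesgue_tuple n')
  end.

End lebesgue_tuple.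

Definition vec (R : realType) (d : nat) (w : d.-tuple (measurableTypeR R)) :
  'rV[R]_d := \row_(i < d) tnth w i.

(* Being mu-a.e. equal to a Borel function is measurability with respect to
   the completion of mu; f \_ D extends f by 0 outside D. *)
Definition Linfty (disp : measure_display) (T : measurableType disp)
    (R : realType) (mu : {measure set T -> \bar R}) (D : set T)
    (f : T -> \bar R) : Prop :=
  (exists2 g : T -> \bar R, measurable_fun D g & ae_eq mu D f g) /\
  (Lnorm mu +oo (f \_ D) < +oo)%E.

Definition Linfty_norm (R : realType) (d : nat) (f : 'rV[R]_d -> R) : \bar R :=
  Lnorm (lebesgue_tuple R d) +oo (fun w => (f (vec w))%:E).

Definition LinftyRd (R : realType) (d : nat) (f : 'rV[R]_d -> R) : Prop :=
  Linfty (lebesgue_tuple R d) setT (fun w => (f (vec w))%:E).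

Definition partial (R : realType) (d : nat) (i : 'I_d) (f : 'rV[R]_d -> R) :
  'rV[R]_d -> R := fun x => 'D_'e_i f x.

(* C^oo_c(R^d): all iterated partial derivatives exist and are continuous. *)
Definition test_function (R : realType) (d : nat) (phi : 'rV[R]_d -> R) : Prop :=
  (forall s : seq 'I_d,
     continuous (foldr (@partial R d) phi s) /\
     forall (i : 'I_d) (x : 'rV[R]_d),
       derivable (foldr (@partial R d) phi s) x 'e_i) /\
  compact (closure [set x | phi x != 0]).

(* G is a (Borel, essentially bounded) representative of the distributional
   gradient of u, which is unique up to a null set. *)
Definition weak_gradient (R : realType) (d : nat) (u : 'rV[R]_d -> R)
    (G : 'rV[R]_d -> 'rV[R]_d) : Prop :=
  forall i : 'I_d,
    measurable_fun setT
      (fun w : d.-tuple (measurableTypeR R) => (G (vec w)) 0 i : measurableTypeR R) /\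
    LinftyRd (fun x => G x 0 i) /\
    forall phi : 'rV[R]_d -> R, test_function phi ->
      \int[lebesgue_tuple R d]_w (u (vec w) * partial i phi (vec w)) =
      - \int[lebesgue_tuple R d]_w (G (vec w) 0 i * phi (vec w)).

(* Every class in W^{1,oo}(R^d) has exactly one continuous representative; as
   the scheme evaluates functions pointwise, the elements of W^{1,oo}(R^d) are
   taken to be these representatives. *)
Definition W1infty (R : realType) (d : nat) (u : 'rV[R]_d -> R) : Prop :=
  [/\ continuous u, LinftyRd u & exists G, weak_gradient u G].

Definition W1infty_grad_le (R : realType) (d : nat) (u : 'rV[R]_d -> R) (C : R) :
    Prop :=
  exists2 G : 'rV[R]_d -> 'rV[R]_d, weak_gradient u G &
    (Linfty_norm (fun x => enorm (G x)) <= C%:E)%E.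

(* A Hamiltonian H is a total function of t : R; all assumptions only concern
   t in [0, T]. *)
Section hamiltonian.
Context (R : realType) (d : nat).
Implicit Types (T K : R) (H : 'rV[R]_d -> R -> 'rV[R]_d -> R).

Definition in_time T (t : R) : Prop := 0 <= t <= T.

Definition hypH1 T H : Prop :=
  forall r : R, 0 < r -> forall eps : R, 0 < eps ->
  exists2 del : R, 0 < del &
    forall (x y : 'rV[R]_d) (t s : R) (p q : 'rV[R]_d),
      in_time T t -> in_time T s -> enorm p < r -> enorm q < r ->
      enorm (x - y) < del -> `|t - s| < del -> enorm (p - q) < del ->
      `|H x t p - H y s q| < eps.

Definition hypH2' T H : Prop :=
  forall r : R, 0 < r -> exists M : R,
    forall (x : 'rV[R]_d) (t : R) (p : 'rV[R]_d),
      in_time T t -> enorm p <= r -> `|H x t p| <= M.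

Definition hypH3 T H : Prop :=
  exists2 eta : R, 0 < eta &
    forall (t : R) (x y p : 'rV[R]_d), in_time T t ->
      `|H x t p - H y t p| <= eta * (1 + enorm p) * enorm (x - y).

Definition hypH4_convex T H : Prop :=
  forall (x : 'rV[R]_d) (t : R), in_time T t ->
    convex_function [set: 'rV[R]_d] (H x t).

Definition hypH4_i T H K : Prop :=
  [/\ 0 < K,
      forall eps : R, 0 < eps -> exists rho : R,
        forall (x : 'rV[R]_d) (t : R) (p : 'rV[R]_d),
          in_time T t -> rho < enorm p -> `|H x t p / enorm p - K| < eps
    & exists alpha : 'rV[R]_d -> R,
        [/\ forall p, 0 < alpha p, LinftyRd alpha &
            forall (x y : 'rV[R]_d) (t : R) (p : 'rV[R]_d), in_time T t ->
              `|H x t p - H y t p| <= alpha p * enorm (x - y)]].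

Definition hypH4_ii T H : Prop :=
  forall M : R, exists rho : R, forall p : 'rV[R]_d, rho < enorm p ->
    (M%:E <= ereal_inf [set (H z.1 z.2 p / enorm p)%R%:E
                       | z in [set z : 'rV[R]_d * R | in_time T z.2]])%E.

Definition hypH4 T H : Prop :=
  hypH4_convex T H /\ ((exists K : R, hypH4_i T H K) \/ hypH4_ii T H).

Definition legendre H (x : 'rV[R]_d) (t : R) (xi : 'rV[R]_d) : \bar R :=
  ereal_sup [set (dot xi p - H x t p)%:E | p in [set: 'rV[R]_d]].

(* H^* belongs to L^oo(Q_T x closed ball of radius K), for the Lebesgue measure
   on R^d x R x R^d. *)
Definition legendre_Linfty T H K : Prop :=
  Linfty (lebesgue_tuple R d \x @lebesgue_measure R \x lebesgue_tuple R d)%E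
    [set z | in_time T z.1.2 /\ enorm (vec z.2) <= K]
    (fun z => legendre H (vec z.1.1) z.1.2 (vec z.2)).

(* Value at xi of the functional minimized at step n, given the values v of the
   scheme at step n. *)
Definition step_cost H (h : R) (n : nat) (v : 'rV[R]_d -> \bar R)
    (x xi : 'rV[R]_d) : \bar R :=
  (v (x - h *: xi)%R + h%:E * legendre H x (n%:R * h)%R xi)%E.

(* Values are a priori extended reals; finiteness is part of the theorem. *)
Fixpoint scheme H (u0 : 'rV[R]_d -> R) (h : R) (n : nat) : 'rV[R]_d -> \bar R :=
  match n with
  | 0 => fun x => (u0 x)%:E
  | n'.+1 => fun x =>
      ereal_inf [set step_cost H h n' (scheme H u0 h n') x xi
                | xi in [set: 'rV[R]_d]]
  end.

Definition argmin H (u0 : 'rV[R]_d -> R) (h : R) (n : nat) (x : 'rV[R]_d) :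
    set 'rV[R]_d :=
  [set xi | step_cost H h n (scheme H u0 h n) x xi = scheme H u0 h n.+1 x].

End hamiltonian.

(* Main.v *)
Require Import Defs.
From HB Require Import structures.
From mathcomp Require Import all_boot all_order all_algebra.
From mathcomp Require Import all_classical all_reals all_analysis measurable_realfun.
From mathcomp Require Import ess_sup_inf ring lra.
Set Implicit Arguments.
Unset Strict Implicit.
Unset Printing Implicit Defensive.
Import Order.TTheory GRing.Theory Num.Theory.
Import numFieldNormedType.Exports.
Local Open Scope classical_set_scope.
Local Open Scope ring_scope.

(** Throughout, the conjugate of H at (x,t) is the function
    xi |-> sup_p (xi.p - H(x,t,p)) that enters the scheme.

    Bounds.  Testing the supremum with p = r xi/|xi| bounds the conjugate from
    below by r|xi| - sup_{|p|<=r} |H| for every r >= 0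
    ([legendre_coercive]), and the growth condition makes H bounded below
    ([hypH4_lower_bound]), so that the conjugate is bounded above at xi = 0.
    If u^n is L-Lipschitz, the choice r = L+1 shows that the functional
    minimized at step n grows at least like h|xi|, so its sublevel sets are
    bounded; being a supremum of continuous functions of xi, it is minimal at
    any cluster point of a minimizing sequence ([next_argmin]).  The choice
    r = L gives |u^{n+1} - u^n| <= C h, and p = 0 gives the uniform bound.

    Lipschitz constant in space.  The difference H(x,t,p) - H(y,t,p) is
    controlled only in terms of |p|, so one has to know that only the slopes
    |p| <= L matter.  This is a duality: for every xi there is s such that the
    conjugate at xi + s, plus L|s|, is the supremum of xi.b - H(x,t,b) over the
    ball |b| <= L, up to an arbitrarily small error ([convex_ball_duality]).  Replacing xi by
        xi + s in the
    minimization costs at most hL|s|, because u^n is L-Lipschitz, and this is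
    what the duality gives back.  Hence
    L_{n+1} <= L_n + h eta (1 + L_n) ([next_lipschitz]), and by induction
    1 + L_n <= (1 + L_0) exp(eta n h).  The vector s is a subgradient at 0 of
    the convex function q |-> inf_{|b|<=L} (H(x,t,q+b) - xi.(q+b)), found one
    coordinate at a time as in the Hahn-Banach theorem
    ([convex_subgradient]).

    Sobolev functions.  The argument above is about bounded Lipschitz functions,
    and these are the elements of W^{1,oo}.
    - If u has an essentially bounded weak gradient G, and a, b differ only in
      coordinate i, test with a product of narrow bumps around the common
      coordinates and, in coordinate i, the difference of the primitives of
      two bumps, around a_i and b_i.  Its i-th derivative is a difference of two
      approximate identities, so the integral of u against it is close to
      u(a) - u(b), while the integral of G_i against it is at most
      |b_i - a_i| times the norm of G_i, up to a small error
      ([W1infty_partial_lipschitz]).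
    - If u is Lipschitz, its weak gradient is the upper limit of the difference
      quotients.  On a line a Lipschitz function F is the integral of its
      derivative: adding a linear function makes F nondecreasing, the
      associated Stieltjes measure is then at most a multiple of the Lebesgue
      measure, and its Radon-Nikodym density is almost everywhere the derivative
      of F by Lebesgue's differentiation theorem ([nondecreasing_density]).
      For F = u phi this is integration by parts on lines
      ([lipschitz_ibp]), and Tonelli's theorem assembles the lines
      ([integral_lines0], [W1infty_of_lipschitz]). *)

(** * The Euclidean norm and the topology of row vectors *)

Section euclid.
Context (R : realType) (d : nat).
Implicit Types (x y z : 'rV[R]_d) (a b c : R).

Lemma dotC x y : dot x y = dot y x.
Proof. by apply: eq_bigr => i _; rewrite mulrC. Qed.

Lemma dotDl x y z : dot (x + y) z = dot x z + dot y z.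
Proof. by rewrite /dot -big_split; apply: eq_bigr => i _; rewrite !mxE mulrDl. Qed.

Lemma dotZl a x y : dot (a *: x) y = a * dot x y.
Proof. by rewrite /dot mulr_sumr; apply: eq_bigr => i _; rewrite !mxE mulrA. Qed.

Lemma dotNl x y : dot (- x) y = - dot x y.
Proof. by rewrite -scaleN1r dotZl mulN1r. Qed.

Lemma dotBl x y z : dot (x - y) z = dot x z - dot y z.
Proof. by rewrite dotDl dotNl. Qed.

Lemma dot0l x : dot 0 x = 0.
Proof. by rewrite -(scale0r 0) dotZl mul0r. Qed.

Lemma dotDr x y z : dot x (y + z) = dot x y + dot x z.
Proof. by rewrite dotC dotDl !(dotC x). Qed.

Lemma dotZr a x y : dot x (a *: y) = a * dot x y.
Proof. by rewrite dotC dotZl dotC. Qed.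

Lemma dotBr x y z : dot x (y - z) = dot x y - dot x z.
Proof. by rewrite dotC dotBl !(dotC x). Qed.

Lemma dot_ge0 x : 0 <= dot x x.
Proof. by apply: sumr_ge0 => i _; rewrite -expr2 sqr_ge0. Qed.

Lemma dot_eq0 x : dot x x = 0 -> x = 0.
Proof.
move=> x0; apply/rowP => i; rewrite mxE; apply/eqP.
have /psumr_eq0P/(_ x0) /(_ i isT) : forall j : 'I_d, true -> 0 <= x 0 j * x 0 j.
  by move=> j _; rewrite -expr2 sqr_ge0.
by move/eqP; rewrite mulf_eq0 orbb.
Qed.

Lemma enorm_ge0 x : 0 <= enorm x.
Proof. exact: sqrtr_ge0. Qed.

Lemma enorm_sqr x : enorm x ^+ 2 = dot x x.
Proof. by rewrite sqr_sqrtr// dot_ge0. Qed.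

Lemma enorm0 : enorm (0 : 'rV[R]_d) = 0.
Proof. by rewrite /enorm dot0l sqrtr0. Qed.

Lemma enormZ a x : enorm (a *: x) = `|a| * enorm x.
Proof.
by rewrite /enorm dotZl dotZr mulrA -expr2 sqrtrM ?sqr_ge0// sqrtr_sqr.
Qed.

Lemma enormN x : enorm (- x) = enorm x.
Proof. by rewrite -scaleN1r enormZ normrN1 mul1r. Qed.

Lemma cauchy_schwarz x y : dot x y <= enorm x * enorm y.
Proof.
have [y0|ny0] := eqVneq (dot y y) 0.
  by rewrite (dot_eq0 y0) dotC dot0l enorm0 mulr0.
have b0 : 0 < dot y y by rewrite lt_neqAle eq_sym ny0 dot_ge0.
have := dot_ge0 (dot y y *: x - dot x y *: y).
rewrite !(dotBl, dotBr, dotZl, dotZr) (dotC y x) => h.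
have h2 : dot x y ^+ 2 <= dot x x * dot y y.
  rewrite -subr_ge0 -(pmulr_rge0 _ b0); apply: le_trans h _.
  by rewrite le_eqVlt; apply/orP; left; apply/eqP; ring.
rewrite (le_trans (ler_norm _))// -(ler_pXn2r (ltn0Sn 1)) ?nnegrE//.
  by rewrite exprMn !enorm_sqr real_normK// num_real.
by rewrite mulr_ge0 ?enorm_ge0.
Qed.

Lemma ler_enormD x y : enorm (x + y) <= enorm x + enorm y.
Proof.
rewrite -(ler_pXn2r (ltn0Sn 1)) ?nnegrE ?addr_ge0 ?enorm_ge0//.
rewrite sqrrD !enorm_sqr dotDl !dotDr (dotC y x).
by have := cauchy_schwarz x y; lra.
Qed.

Lemma ler_enorm_coord x i : `|x 0 i| <= enorm x.
Proof.
rewrite -(ler_pXn2r (ltn0Sn 1)) ?nnegrE ?enorm_ge0// enorm_sqr real_normK ?num_real//.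
rewrite /dot (bigD1 i)//= -expr2 lerDl sumr_ge0// => j _.
by rewrite -expr2 sqr_ge0.
Qed.

Lemma ler_enorm_sum x : enorm x <= \sum_i `|x 0 i|.
Proof.
rewrite -(ler_pXn2r (ltn0Sn 1)) ?nnegrE ?sumr_ge0 ?enorm_ge0//.
rewrite enorm_sqr expr2 mulr_suml; apply: ler_sum => i _.
rewrite (le_trans (ler_norm _))// normrM ler_wpM2l// (bigD1 i)//= lerDl.
by rewrite sumr_ge0.
Qed.

Lemma enorm_le_const x a : 0 <= a -> (forall i, `|x 0 i| <= a) -> enorm x <= d%:R * a.
Proof.
move=> a0 xa; rewrite (le_trans (ler_enorm_sum x))//.
by rewrite (le_trans (ler_sum _ (fun i _ => xa i)))// sumr_const card_ord mulr_natl.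
Qed.

Lemma nbhs_coordP x (P : set 'rV[R]_d) :
  nbhs x P <-> exists2 e, 0 < e & forall y, (forall i, `|y 0 i - x 0 i| < e) -> P y.
Proof.
split.
  move=> /nbhs_ballP[e /= e0 H]; exists e => // y yx; apply: H.
  by split => // i j; rewrite [i]ord1 /ball/= distrC.
move=> [e e0 H]; apply/nbhs_ballP; exists e => //= y yx; apply: H => i.
by have [_ /(_ 0 i)] := yx; rewrite /ball/= distrC.
Qed.

Lemma nbhs_enormP x (P : set 'rV[R]_d) :
  nbhs x P <-> exists2 e, 0 < e & forall y, enorm (y - x) < e -> P y.
Proof.
split.
  move=> /nbhs_coordP[e e0 H]; exists e => // y yx; apply: H => i.
  by rewrite (le_lt_trans _ yx)// (le_trans _ (ler_enorm_coord _ i))// !mxE.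
move=> [e e0 H]; apply/nbhs_coordP; exists (e / d.+1%:R).
  by rewrite divr_gt0.
move=> y yx; apply: H; apply: (@le_lt_trans _ _ (d%:R * (e / d.+1%:R))).
  apply: enorm_le_const => [|i]; first by rewrite divr_ge0// ltW.
  by rewrite !mxE ltW.
rewrite mulrCA gtr_pMr// ltr_pdivrMr// mul1r ltr_nat//.
Qed.

Lemma continuous_enormP (f : 'rV[R]_d -> R) : continuous f <->
  forall x e, 0 < e -> exists2 del, 0 < del &
    forall y, enorm (y - x) < del -> `|f y - f x| < e.
Proof.
split.
  move=> cf x e e0; have /cvgrPdist_lt/(_ _ e0)/nbhs_enormP[r r0 H] := cf x.
  by exists r => // y /H; rewrite distrC.
move=> H x; apply/(@cvgrPdist_lt _ _ _ (nbhs x) (nbhs_filter x)) => e e0;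
    have [r r0 h] := H x e e0.
by apply/nbhs_enormP; exists r => // y /h; rewrite distrC.
Qed.

Lemma lipschitz_continuous (f : 'rV[R]_d -> R) (L : R) :
  (forall x y, `|f x - f y| <= L * enorm (x - y)) -> continuous f.
Proof.
move=> fL; apply/continuous_enormP => x e e0; exists (e / (`|L| + 1)).
  by rewrite divr_gt0// ltr_wpDl.
move=> y; rewrite ltr_pdivlMr ?ltr_wpDl// => yx.
apply: le_lt_trans yx; rewrite mulrC (le_trans (fL _ _))// ler_wpM2r ?enorm_ge0//.
by rewrite (le_trans (ler_norm _))// lerDl.
Qed.

End euclid.

Lemma compact_supp_bounded (R : realType) (T : topologicalType) (f : T -> R)
    (K : set T) : continuous f -> compact K -> (forall x, ~ K x -> f x = 0) ->
  exists2 C, 0 < C & forall x, `|f x| <= C.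
Proof.
move=> cf cK f0.
have : compact (f @` K).
  by apply: continuous_compact => //; exact: continuous_subspaceT.
move/compact_bounded => [M [_ /(_ (`|M| + 1))]].
have -> : M < `|M| + 1 by rewrite (le_lt_trans (ler_norm _))// ltrDl.
move=> /(_ isT) H; exists (`|M| + 1); first by rewrite ltr_wpDl.
move=> x; have [Kx|/f0 ->] := pselect (K x); last by rewrite normr0 addr_ge0.
by apply: H; exists x.
Qed.

(** * Lipschitz functions of one variable *)

Section lipschitz_ftc.
Context (R : realType).
Notation mu := (@lebesgue_measure R).

(** Both measures are outer measures generated by lengths of half-open
    intervals, so it suffices to compare the lengths. *)
Lemma stieltjes_le_lebesgue (F : cumulative R R) (c : R) : 0 < c ->
  (forall x y, x <= y -> F y - F x <= c * (y - x)) ->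
  forall A, (lebesgue_stieltjes_measure F A <= c%:E * mu A)%E.
Proof.
move=> c0 hF A; rewrite -lee_pdivrMl//.
rewrite /mu /lebesgue_measure /lebesgue_stieltjes_measure /measure_extension /=.
apply: le_ereal_inf_tmp => _ [B [mB AB] <-].
rewrite lee_pdivrMl//.
rewrite -nneseriesZl; last by move=> i _; exact: wlength_ge0.
apply: (@le_trans _ _ (\sum_(k <oo) wlength F (B k))%E).
  by apply: ereal_inf_lbound; exists B.
apply: lee_nneseries => // k _ .
have [[a b] _ /= <-] := mB k.
rewrite !wlength_itv /= !lte_fin; case: ifPn => ab; last by rewrite mule0.
by rewrite -!EFinD -EFinM lee_fin hF// ltW.
Qed.

(** Restricting the Stieltjes measure of F to ]-k, k] makes it finite; it is
    dominated by the Lebesgue measure, and the integral of its Radon-Nikodym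
    density over ]-oo, x] is F x - F (- k) for x in that interval. *)
Lemma nondecreasing_density (F : R -> R) (c k : R) : 0 < c -> 0 < k ->
  (forall x y, x <= y -> 0 <= F y - F x <= c * (y - x)) ->
  exists f : R -> R, [/\ mu.-integrable setT (EFin \o f),
    {ae mu, forall x, - k < x < k -> is_derive x 1 F (f x)} &
    \int[mu]_(x in `]-k, k]) f x = F k - F (- k)].
Proof.
move=> c0 k0 hF.
have Fnd : nondecreasing F.
  by move=> x y xy; rewrite -subr_ge0; have /andP[] := hF _ _ xy.
have Frc : right_continuous F.
  move=> x; apply/cvgrPdist_le => e e0; near=> y.
  have xy : x <= y by near: y; exact: nbhs_right_ge.
  rewrite distrC ger0_norm ?subr_ge0; last exact: Fnd.
  have /andP[_ /le_trans] := hF _ _ xy; apply.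
  rewrite -ler_pdivlMl// lerBlDl; near: y; apply: nbhs_right_le.
  by rewrite ltrDl mulr_gt0// invr_gt0.
pose G : cumulative R R := HB.pack F (isCumulative.Build R _ R F Fnd Frc).
have mD : measurable (`]-k, k]%classic : set (measurableTypeR R)) by exact: measurable_itv.
have GE a b : a <= b -> lebesgue_stieltjes_measure G `]a, b] = (F b - F a)%:E.
  move=> ab; rewrite /lebesgue_stieltjes_measure /measure_extension/=.
  rewrite (@measurable_mu_extE _ _ _ (wlength G)); last exact: is_ocitv.
  by rewrite /= wlength_itv_bnd.
have kk : - k <= k by rewrite (le_trans (ltW _) (ltW k0))// oppr_lt0.
have Dlty : (lebesgue_stieltjes_measure G `](- k)%R, k] < +oo)%E.
  by rewrite GE// ltry.
pose nu : {finite_measure set (measurableTypeR R) -> \bar R} := mfrestr mD Dlty.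
have numu : nu `<< mu.
  apply/null_content_dominatesP => A mA muA0.
  apply/eqP; rewrite eq_le measure_ge0 andbT.
  rewrite /nu/= /mfrestr /mrestr.
  apply: (le_trans (stieltjes_le_lebesgue c0 _ _)).
    by move=> x y /hF/andP[].
  rewrite (_ : mu _ = 0%E) ?mule0//.
  by apply: (subset_measure0 _ mA) => //; exact: measurableI.
have [f [f0 ffin intf nuE]] := radon_nikodym_sigma_finite numu.
have fE : EFin \o (fine \o f) = f by apply/funext => x /=; rewrite fineK.
exists (fine \o f); split.
- by rewrite fE.
- have locf : locally_integrable setT (fine \o f).
    by apply: open_integrable_locally; [exact: openT|rewrite fE].
  have intfy y : mu.-integrable `]-oo, y] (EFin \o (fine \o f)).
    by rewrite fE; exact: integrableS intf.
  have := FTC1Ny intfy locf.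
  apply: filterS; first exact: (ae_filter_ringOfSetsType mu).
  move=> x [dI IE] /andP[kx xk].
  have H1 : is_derive x 1 (fun y => \int[mu]_(t in `]-oo, y]) (fine \o f) t + F (- k)) ((fine
      \o f) x + 0).
    apply: is_deriveD; rewrite -IE derive1E; exact/derivableP.
  rewrite addr0 in H1; apply: near_eq_is_derive H1.
  have : \forall y \near x, - k < y < k.
    near=> y; apply/andP; split; near: y; [exact: lt_nbhsr|exact: lt_nbhsl].
  apply: filterS => y /andP[ky yk].
  rewrite /Rintegral (_ : (\int[mu]_(t in `]-oo, y]) _)%E = (F y - F (- k))%:E) /= ?subrK//.
  rewrite -[LHS]/(\int[mu]_(x in `]-oo, y]) ((EFin \o (fine \o f)) x))%E.
  rewrite fE -nuE// /nu/= /mfrestr/mrestr -GE ?(ltW ky)//; congr (lebesgue_stieltjes_measure G _).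
  apply/seteqP; split => z /=; rewrite !in_itv/=.
    by move=> [zy /andP[-> _]].
  by move=> /andP[-> zy]; split => //; rewrite (le_trans zy)// ltW.
- rewrite /Rintegral -[X in fine X]/(\int[mu]_(x in `](- k)%R, k]) ((EFin \o (fine \o f)) x))%E.
  rewrite fE -nuE// /nu/= /mfrestr/mrestr setIid GE//.
Unshelve. all: by end_near. Qed.
End lipschitz_ftc.

Lemma integrable_bounded_supp d (T : measurableType d) (R : realType)
    (mu : {measure set T -> \bar R}) (A : set T) (f : T -> R) (C : R) :
  measurable A -> (mu A < +oo)%E -> measurable_fun setT f ->
  (forall x, `|f x| <= C) -> (forall x, ~ A x -> f x = 0) ->
  mu.-integrable setT (EFin \o f).
Proof.
move=> mA muA mf fC f0.
have -> : EFin \o f = (EFin \o f) \_ A.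
  apply/funext => x /=; rewrite patchE; case: ifPn => //= /negP xA.
  by rewrite f0// => /mem_set.
rewrite -integrable_mkcond//; apply: measurable_bounded_integrable => //.
  exact: measurable_funTS.
exists C; split; first exact: num_real.
by move=> y /ltW Cy x /= _; exact: le_trans Cy.
Qed.

Lemma lebesgue_segment_lty (R : realType) (a b : R) :
  (lebesgue_measure (`[a, b]%classic : set R) < +oo)%E.
Proof. by rewrite lebesgue_measure_itv/=; case: ifP => _; rewrite -?EFinB ltry. Qed.

Section lipschitz_ibp.
Context (R : realType).
Notation mu := (@lebesgue_measure R).

(** A Lipschitz function becomes nondecreasing once L * x is added to it. *)
Lemma lipschitz_density (F : R -> R) (L k : R) : 0 < L -> 0 < k ->
  (forall x y, `|F x - F y| <= L * `|x - y|) ->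
  exists f : R -> R, [/\ mu.-integrable `]-k, k] (EFin \o f),
    {ae mu, forall x, - k < x < k -> is_derive x 1 F (f x)} &
    \int[mu]_(x in `]-k, k]) f x = F k - F (- k)].
Proof.
move=> L0 k0 hF.
have [f [intf dF If]] : exists f : R -> R, [/\ mu.-integrable setT (EFin \o f),
    {ae mu, forall x, - k < x < k -> is_derive x 1 (fun x => F x + L * x) (f x)} &
    \int[mu]_(x in `]-k, k]) f x = (F k + L * k) - (F (- k) + L * (- k))].
  apply: (@nondecreasing_density _ _ (2 * L)) => //; first by rewrite mulr_gt0.
  move=> x y xy; have := hF y x.
  rewrite ler_norml ger0_norm ?subr_ge0// => /andP[h1 h2].
  by apply/andP; split; lra.
have kk : - k <= k by rewrite (le_trans (ltW _) (ltW k0))// oppr_lt0.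
have mkk : mu `]-k, k] = (2 * k)%:E.
  by rewrite lebesgue_measure_itv/= lte_fin gtrN// -EFinB opprK mulr2n mulrDl mul1r.
have intf' : mu.-integrable `]-k, k] (EFin \o f).
  exact: integrableS intf.
have intL : mu.-integrable `]-k, k] (EFin \o cst L).
  apply: measurable_bounded_integrable => //; first by rewrite [ltLHS]mkk ltry.
  by exists `|L|; split; [exact: num_real|move=> y /ltW ? x _].
exists (fun x => f x - L); split.
- rewrite (_ : EFin \o _ = (EFin \o f) \- (EFin \o cst L))%E//.
  exact: integrableB.
- move: dF; apply: filterS; first exact: (ae_filter_ringOfSetsType mu).
  move=> x /[apply] dF.
  have -> : F = (fun x => F x + L * x) - (fun x => L * x).
    by apply/funext => y; rewrite !fctE addrK.
  apply: is_deriveB; rewrite -[X in is_derive _ _ _ X]mulr1.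
  exact: is_deriveZ.
- rewrite RintegralB// If Rintegral_cst// [X in fine X]mkk /=; ring.
Qed.

(** Integration by parts against a C^1 function with compact support: the
    product g * phi is Lipschitz, hence the integral of its derivative, and it
    vanishes at both ends.  The function D stands for any bounded measurable
    function extending the almost everywhere defined derivative of g. *)
Lemma lipschitz_ibp (g phi phi' D : R -> R) (L M k : R) : 0 < L -> 0 < k ->
  (forall x y, `|g x - g y| <= L * `|x - y|) -> (forall x, `|g x| <= M) ->
  (forall x : R, is_derive x 1 phi (phi' x)) -> continuous phi' ->
  (forall x, k <= `|x| -> phi x = 0) ->
  measurable_fun setT D -> (forall x, `|D x| <= L) ->
  (forall x : R, derivable g x 1 -> D x = 'D_1 g x) ->
  (\int[mu]_x (g x * phi' x + D x * phi x)%:E = 0)%E.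
Proof.
move=> L0 k0 gL gM dphi cphi' phi0 mD DL gD.
have cphi : continuous phi.
  by move=> x; apply: differentiable_continuous; apply/derivable1_diffP;
      exact: (@ex_derive _ _ _ _ _ _ _ (dphi x)).
have phi'0 x : k < `|x| -> phi' x = 0.
  move=> kx; have <- := @derive_val _ _ _ _ _ _ _ (dphi x).
  apply/eqP; rewrite -(derive_cst (0:R) x 1); apply/eqP; apply: near_eq_derive.
  have : \forall y \near x, k < `|y|.
    have /cvgrPdist_lt/(_ (`|x| - k)) : (`|y| @[y --> x]) --> `|x|.
      exact: norm_continuous.
    rewrite subr_gt0 => /(_ kx); apply: filterS => y h.
    by move: (le_lt_trans (ler_norm _) h); lra.
  by apply: filterS => y /ltW /phi0.
have notK x : ~ `[- k, k]%classic x -> k < `|x|.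
  by rewrite /= in_itv/= -ler_norml => /negP; rewrite -ltNge.
have [C1 C10 phiC] := compact_supp_bounded cphi (@segment_compact _ (- k) k)
  (fun x Kx => phi0 x (ltW (notK x Kx))).
have [C2 C20 phi'C] := compact_supp_bounded cphi' (@segment_compact _ (- k) k)
  (fun x Kx => phi'0 x (notK x Kx)).
have phiL x y : `|phi x - phi y| <= C2 * `|x - y|.
  wlog xy : x y / x <= y.
    move=> h; have [/h//|/ltW /h] := leP x y.
    by rewrite distrC (distrC x).
  rewrite distrC (distrC x).
  have [z _ ->] : exists2 c, c \in `[x, y] & phi y - phi x = phi' c * (y - x).
    by apply: MVT_segment => //; exact: continuous_subspaceT.
  by rewrite normrM ler_wpM2r.
have M0 : 0 <= M by rewrite (le_trans _ (gM 0)).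
pose P x := g x * phi x.
have PL x y : `|P x - P y| <= (L * C1 + M * C2) * `|x - y|.
  have -> : P x - P y = (g x - g y) * phi x + g y * (phi x - phi y).
    by rewrite /P; ring.
  rewrite (le_trans (ler_normD _ _))// !normrM mulrDl lerD//.
    by rewrite mulrAC ler_pM.
  by rewrite -mulrA ler_pM.
have k10 : 0 < k + 1 by rewrite addr_gt0.
(* on ]-(k+1), k+1] the integrand is almost everywhere the derivative of P *)
have [f [intf dP If]] := lipschitz_density
  (ltr_wpDr (mulr_ge0 M0 (ltW C20)) (mulr_gt0 L0 C10)) k10 PL.
have [f' [intf' dg _]] := lipschitz_density L0 k10 gL.
have cg : continuous g.
  move=> x; apply/cvgrPdist_le => e e0; near=> y.
  rewrite (le_trans (gL _ _))// -ler_pdivlMl//.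
  near: y; apply: cvgr_dist_le; first exact: cvg_id.
  by rewrite mulr_gt0// invr_gt0.
set h := fun x => _.
have h0 x : ~ (`](- (k+1))%R, (k+1)%R]%classic : set R) x -> h x = 0%:E.
  rewrite /= in_itv/= => /negP xk.
  have kx : k < `|x|.
    rewrite ltNge; apply: contra xk; rewrite ler_norml => /andP[? ?].
    by apply/andP; split; lra.
  by rewrite /h phi'0// phi0 ?(ltW kx)// !mulr0 addr0.
have -> : (\int[mu]_x h x = \int[mu]_(x in `](- (k+1))%R, (k+1)%R]) h x)%E.
  rewrite [RHS]integral_mkcond; apply: eq_integral => x _.
  by rewrite patchE; case: ifPn => // /negP xk; rewrite h0// => /mem_set.
have mh : measurable_fun setT h.
  apply/measurable_EFinP; apply: measurable_funD; apply: measurable_funM => //;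
  exact: continuous_measurable_fun.
have -> : (\int[mu]_(x in `](- (k+1))%R, (k+1)%R]) h x =
    \int[mu]_(x in `](- (k+1))%R, (k+1)%R]) (f x)%:E)%E.
  apply: ae_eq_integral => //.
  - exact: measurable_funTS.
  - exact: measurable_int intf.
  - have dk : {ae mu, forall x, x != k + 1}.
      exists [set k + 1]; split => //; first exact: lebesgue_measure_set1.
      by move=> x /= /negP; rewrite negbK => /eqP.
    near=> x.
    rewrite /= in_itv/= => /andP[xk1 xk2].
    have xk : - (k + 1) < x < k + 1.
      by rewrite xk1 lt_neqAle xk2 andbT; near: x.
    have dPx : is_derive x 1 P (f x) by move: xk; near: x.
    have dgx : is_derive x 1 g (f' x) by move: xk; near: x.
    have gx : D x = f' x.
      rewrite gD; first exact: derive_val.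
      exact: (@ex_derive _ _ _ _ _ _ _ dgx).
    have dPx' : is_derive x 1 P (g x *: phi' x + phi x *: f' x).
      exact: is_deriveM.
    have -> : f x = g x * phi' x + f' x * phi x.
      rewrite -(@derive_val _ _ _ _ _ _ _ dPx) (@derive_val _ _ _ _ _ _ _ dPx').
      by congr (_ + _); exact: mulrC.
    by rewrite /h gx.
have Pk x : k < `|x| -> P x = 0 by move=> kx; rewrite /P phi0 ?mulr0// ltW.
have kk1 : k < `|k + 1| by rewrite gtr0_norm// ltrDl.
move: If; rewrite (Pk (k+1))// (Pk (- (k+1))) ?normrN// subrr /Rintegral => If.
by rewrite -[LHS]fineK ?If//; exact: integrable_fin_num.
Unshelve. all: by end_near. Qed.
End lipschitz_ibp.

(** * Integration over d-tuples *)

Section tuple_measure.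
Context (R : realType).
Notation Rm := (measurableTypeR R).
Notation mu := (@lebesgue_measure R).
Local Open Scope ereal_scope.

(** The line through w parallel to the i-th axis, parametrized by its i-th
    coordinate. *)
Definition set_tnth (n : nat) (w : n.-tuple Rm) (i : 'I_n) (s : Rm) : n.-tuple Rm :=
  [tuple if j == i then s else tnth w j | j < n].

(** The measure of dimension n.+1 is the image of a product measure under
    [cons_tup], so Tonelli's theorem applies to it in both orders. *)
Lemma tonelli_tuple1 n (F : n.+1.-tuple Rm -> \bar R) :
  measurable_fun setT F -> (forall w, 0 <= F w) ->
  \int[lebesgue_tuple R n.+1]_w F w =
  \int[mu]_x \int[lebesgue_tuple R n]_w F (cons_tup (x, w)).
Proof.
move=> mF F0.
have mFc : measurable_fun setT (F \o @cons_tup R n).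
  exact: (measurableT_comp mF (@measurable_cons_tup R n)).
transitivity (\int[@lebesgue_measure R \x lebesgue_tuple R n]_z (F \o @cons_tup R n) z);
    last first.
  by apply: fubini_tonelli1 => // z; exact: F0.
rewrite -[LHS]/(\int[pushforward (mu \x lebesgue_tuple R n) (@cons_tup R n)]_w F w).
by rewrite ge0_integral_pushforward //; exact: measurable_cons_tup.
Qed.

Lemma tonelli_tuple2 n (F : n.+1.-tuple Rm -> \bar R) :
  measurable_fun setT F -> (forall w, 0 <= F w) ->
  \int[lebesgue_tuple R n.+1]_w F w =
  \int[lebesgue_tuple R n]_w \int[mu]_x F (cons_tup (x, w)).
Proof.
move=> mF F0; rewrite tonelli_tuple1//.
apply: (fubini_tonelli (F \o @cons_tup R n)) => [|z]; last exact: F0.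
exact: (measurableT_comp mF (@measurable_cons_tup R n)).
Qed.

Lemma set_tnth_cons0 n (x s : Rm) (w : n.-tuple Rm) :
  set_tnth (cons_tup (x, w)) ord0 s = cons_tup (s, w).
Proof.
apply: eq_from_tnth => j; rewrite tnth_mktuple.
case: (unliftP ord0 j) => [k ->|->]; last by rewrite eqxx tnth0.
by rewrite eq_sym (negbTE (neq_lift _ _)) !tnthS.
Qed.

Lemma set_tnth_consS n (x s : Rm) (w : n.-tuple Rm) i :
  set_tnth (cons_tup (x, w)) (lift ord0 i) s = cons_tup (x, set_tnth w i s).
Proof.
apply: eq_from_tnth => j; rewrite tnth_mktuple.
case: (unliftP ord0 j) => [k ->|->]; last by rewrite !tnth0 (negbTE (neq_lift _ _)).
by rewrite !tnthS tnth_mktuple (inj_eq (@lift_inj _ _)).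
Qed.

(** The nonnegative form of Fubini's theorem with the i-th coordinate
    innermost; stating it as a comparison of two integrands avoids naming the
    measure on the remaining coordinates.  Induction on n peels off the first
    coordinate: it is the innermost variable if i is the first coordinate, and
    a parameter otherwise. *)
Lemma integral_lines n (i : 'I_n) (F G : n.-tuple Rm -> \bar R) :
  measurable_fun setT F -> (forall w, 0 <= F w) ->
  measurable_fun setT G -> (forall w, 0 <= G w) ->
  (forall w, \int[mu]_s F (set_tnth w i s) = \int[mu]_s G (set_tnth w i s)) ->
  \int[lebesgue_tuple R n]_w F w = \int[lebesgue_tuple R n]_w G w.
Proof.
elim: n i F G => [[]//|n IH] i F G mF F0 mG G0 FG.
case: (unliftP ord0 i) => [j|] ij; last first.
  rewrite (tonelli_tuple2 mF F0) (tonelli_tuple2 mG G0); apply: eq_integral => w _.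
  have := FG (cons_tup (0%R, w)); rewrite ij.
  by under eq_integral do rewrite set_tnth_cons0;
      under [RHS]eq_integral do rewrite set_tnth_cons0.
rewrite (tonelli_tuple1 mF F0) (tonelli_tuple1 mG G0); apply: eq_integral => x _.
have mc : measurable_fun setT (fun w : n.-tuple Rm => cons_tup (x, w)).
  exact: (measurableT_comp (@measurable_cons_tup R n) (pair1_measurable _)).
apply: (IH j) => //.
- exact: (measurableT_comp mF mc).
- exact: (measurableT_comp mG mc).
move=> w; have := FG (cons_tup (x, w)); rewrite ij.
by under eq_integral do rewrite set_tnth_consS; under [RHS]eq_integral do rewrite set_tnth_consS.
Qed.

Lemma integral_prod_tuple n (f : 'I_n -> Rm -> R) (c : 'I_n -> R) :
  (forall i, measurable_fun setT (f i)) -> (forall i x, 0 <= f i x)%R ->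
  (forall i, \int[mu]_x (f i x)%:E = (c i)%:E) ->
  \int[lebesgue_tuple R n]_w (\prod_(i < n) f i (tnth w i))%:E =
  (\prod_(i < n) c i)%:E.
Proof.
elim: n f c => [|n IH] f c mf f0 fc.
  rewrite big_ord0 (eq_integral (cst 1)).
    by rewrite integral_cst// mul1e /= diracT.
  by move=> w _; rewrite big_ord0.
have mprod m (g : 'I_m -> Rm -> R) : (forall i, measurable_fun setT (g i)) ->
    measurable_fun setT (fun w : m.-tuple Rm => (\prod_(i < m) g i (tnth w i))%:E).
  move=> mg; apply/measurable_EFinP; apply: measurable_prod => i _.
  exact: (measurableT_comp (mg i) (measurable_tnth i)).
rewrite tonelli_tuple1//; last 2 first.
- exact: mprod.
- by move=> w; rewrite lee_fin prodr_ge0.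
rewrite big_ord_recl EFinM -fc -ge0_integralZr//; last 3 first.
- by apply/measurable_EFinP.
- by move=> x _; rewrite lee_fin.
- rewrite lee_fin prodr_ge0// => i _; rewrite -lee_fin -fc.
  by apply: integral_ge0 => x _; rewrite lee_fin.
apply: eq_integral => x _.
transitivity (\int[lebesgue_tuple R n]_w
    ((f ord0 x)%:E * (\prod_(i < n) f (lift ord0 i) (tnth w i))%:E)).
  apply: eq_integral => w _; rewrite big_ord_recl tnth0 EFinM.
  by congr (_ * _%:E); apply: eq_bigr => i _; rewrite tnthS.
rewrite ge0_integralZl_EFin//.
- by congr (_ * _); apply: (IH (fun i => f (lift ord0 i)) (fun i => c (lift ord0 i))) => // i.
- by move=> w _; rewrite lee_fin prodr_ge0.
- exact: (mprod _ (fun i => f (lift ord0 i))).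
Qed.

End tuple_measure.

Section tuple_measurability.
Context (R : realType).
Notation Rm := (measurableTypeR R).
Notation mu := (@lebesgue_measure R).

Lemma vec_set_tnth n (w : n.-tuple Rm) i s j :
  vec (set_tnth w i s) 0 j = if j == i then s else vec w 0 j.
Proof. by rewrite !mxE tnth_mktuple. Qed.

(** Rounding all coordinates down to multiples of 1/(k+1) turns f into a
    function that takes countably many values, each on a measurable set; by
    continuity these functions converge to f. *)
Lemma measurable_vec_continuous n (f : 'rV[R]_n -> R) : continuous f ->
  measurable_fun setT (fun w : n.-tuple Rm => f (vec w) : R).
Proof.
move=> cf.
pose cell (k : nat) (w : n.-tuple Rm) : {ffun 'I_n -> int} :=
  [ffun i => Num.floor (k.+1%:R * tnth w i)].
pose pt (k : nat) (z : {ffun 'I_n -> int}) : 'rV[R]_n :=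
  \row_i ((z i)%:~R / k.+1%:R).
apply: (@measurable_fun_cvg _ _ _ _ (fun k w => f (pt k (cell k w)))).
  move=> k _ Y mY; rewrite setTI.
  have -> : (fun w => f (pt k (cell k w))) @^-1` Y =
      \bigcup_(z : {ffun 'I_n -> int}) (if `[< Y (f (pt k z)) >] then
        \bigcap_(i : 'I_n) [set w : n.-tuple Rm | (z i)%:~R <= k.+1%:R * tnth w i < (z i +
            1)%:~R] else set0).
    apply/seteqP; split => [w /= Yw|w [z _]].
      exists (cell k w) => //; rewrite asboolT// => i _ /=; rewrite ffunE.
      exact: floor_itv.
    case: ifPn => [/asboolP Yz zw|]//; rewrite /preimage/=.
    suff -> : cell k w = z by [].
    apply/ffunP => i; rewrite ffunE; apply: floor_def; exact: zw.
  apply: countable_bigcupT_measurable => // z.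
  case: ifPn => // _; apply: fin_bigcap_measurable => //.
  move=> i _.
  have mi : measurable_fun setT (fun w : n.-tuple Rm => k.+1%:R * tnth w i : R).
    by apply: measurable_funM => //; exact: measurable_tnth.
  have := mi measurableT `[((z i)%:~R : R), (z i + 1)%:~R[%classic.
  rewrite setTI; move=> /(_ _); rewrite (_ : _ @^-1` _ =
      [set w : n.-tuple Rm | (z i)%:~R <= k.+1%:R * tnth w i < (z i + 1)%:~R]).
    by apply; exact: measurable_itv.
  by apply/seteqP; split => w /=; rewrite in_itv.
move=> w _; apply/cvgrPdist_lt => e e0.
have [r r0 H] := (continuous_enormP f).1 cf (vec w) e e0.
near=> k; rewrite distrC; apply: H.
apply: (@le_lt_trans _ _ (n%:R * k.+1%:R^-1)).
  apply: enorm_le_const => [|i]; first by rewrite invr_ge0.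
  rewrite !mxE ffunE ler_norml.
  have /andP[h1 h2] := floor_itv (k.+1%:R * tnth w i).
  have k0 : 0 < k.+1%:R :> R by [].
  rewrite -(ler_pM2r k0) -[X in _ && X](ler_pM2r k0) mulrBl divfK// mulNr mulVf//.
  by move: h2; rewrite intrD => h2; apply/andP; split; lra.
rewrite ltr_pdivrMr// mulrC -ltr_pdivrMr// mulrC.
near: k; apply: filterS (nbhs_infty_gtr (r^-1 * n%:R)) => k.
by move=> /lt_trans; apply; rewrite ltr_nat.
Unshelve. all: by end_near. Qed.

Definition box n (a b : 'rV[R]_n) : set (n.-tuple Rm) :=
  [set w | forall i, a 0 i <= tnth w i <= b 0 i].

Lemma measurable_box n (a b : 'rV[R]_n) : measurable (box a b).
Proof.
rewrite (_ : box a b =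
    \bigcap_(i : 'I_n) ((fun w : n.-tuple Rm => tnth w i) @^-1` `[a 0 i, b 0 i])).
  apply: fin_bigcap_measurable; first exact: finite_finset.
  move=> i _; rewrite -[X in measurable X]setTI.
  exact: (@measurable_tnth _ Rm n i measurableT _ (measurable_itv `[a 0 i, b 0 i])).
apply/seteqP; split => w; first by move=> h i _ /=; rewrite in_itv/=.
by move=> h i; have := h i Logic.I; rewrite /= in_itv.
Qed.

Lemma integral_indic_itv (a b : R) : a <= b ->
  (\int[mu]_x (\1_(`[a, b]%classic : set R) x)%:E = (b - a)%:E)%E.
Proof.
move=> ab; transitivity (mu `[a, b]); first by rewrite integral_indic// setIT.
rewrite lebesgue_measure_itv/= lte_fin -EFinB.
by case: ltgtP ab => // -> _; rewrite subrr.
Qed.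

Lemma box_finite n (a b : 'rV[R]_n) : (forall i, a 0 i <= b 0 i) ->
  (lebesgue_tuple R n (box a b) < +oo)%E.
Proof.
move=> ab.
pose f (i : 'I_n) : R -> R := \1_(`[a 0 i, b 0 i]%classic : set R).
have := @integral_prod_tuple R n f (fun i => b 0 i - a 0 i).
have -> : (\int[lebesgue_tuple R n]_w (\prod_(i < n) f i (tnth w i))%:E =
    lebesgue_tuple R n (box a b))%E.
  transitivity (\int[lebesgue_tuple R n]_w (\1_(box a b) w)%:E)%E; last first.
    by rewrite integral_indic ?setIT//; exact: measurable_box.
  apply: eq_integral => w _; congr EFin; rewrite indicE.
  have [h|h] := boolP (w \in box a b).
    rewrite big1// => i _; rewrite /f indicE mem_set//= in_itv/=.
    by move: h; rewrite inE; apply.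
  have [i hi] : exists i, ~~ (a 0 i <= tnth w i <= b 0 i).
    apply/existsP; rewrite -negb_forall; apply: contra h => /forallP h.
    by rewrite inE.
  rewrite (bigD1 i)//= /f indicE memNset ?mul0r//= in_itv/=; exact/negP.
move=> ->; rewrite /f ?ltry// => i; exact: integral_indic_itv.
Qed.

Lemma integrable_box n (F : n.-tuple Rm -> R) (a b : 'rV[R]_n) (C : R) :
  (forall i, a 0 i <= b 0 i) -> measurable_fun setT F ->
  (forall w, `|F w| <= C) -> (forall w, ~ box a b w -> F w = 0) ->
  (lebesgue_tuple R n).-integrable setT (EFin \o F).
Proof.
move=> ab mF FC F0; apply: (@integrable_bounded_supp _ _ _ _ (box a b) _ C) => //.
  exact: measurable_box.
exact: box_finite.
Qed.

(** Signed version: on each line the integrals of the positive and negative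
    parts agree. *)
Lemma integral_lines0 n (i : 'I_n) (F : n.-tuple Rm -> R) :
  measurable_fun setT F ->
  (forall w, mu.-integrable setT (fun s => (F (set_tnth w i s))%:E)) ->
  (forall w, \int[mu]_s (F (set_tnth w i s))%:E = 0)%E ->
  (lebesgue_tuple R n).-integrable setT (EFin \o F) ->
  \int[lebesgue_tuple R n]_w F w = 0.
Proof.
move=> mF intF F0 iF.
have h : (\int[lebesgue_tuple R n]_w ((EFin \o F)^\+ w) =
    \int[lebesgue_tuple R n]_w ((EFin \o F)^\- w))%E.
  apply: (integral_lines (i := i)) => //.
  - by apply: measurable_funepos; exact/measurable_EFinP.
  - by apply: measurable_funeneg; exact/measurable_EFinP.
  move=> w; have := F0 w; rewrite integralE => /eqP.
  rewrite sube_eq ?add0e; last 2 first.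
  - by apply: integrable_pos_fin_num => //; exact: intF.
  - by rewrite fin_num_adde_defl//; apply: integrable_neg_fin_num => //; exact: intF.
  by move/eqP; rewrite !unlock.
rewrite /Rintegral -[X in fine X]/(\int[lebesgue_tuple R n]_w ((EFin \o F) w))%E.
by rewrite integralE h subee//; exact: integrable_neg_fin_num.
Qed.

End tuple_measurability.

(** * Bounded Lipschitz functions are in W^{1,oo} *)

Section lines.
Context (R : realType) (n : nat).
Notation Rm := (measurableTypeR R).
Implicit Types (f : 'rV[R]_n -> R) (w : n.-tuple Rm) (i : 'I_n).

Lemma vec_set_tnth_shift w i (s h : R) :
  vec (set_tnth w i (h + s)) = h *: 'e_i + vec (set_tnth w i s).
Proof.
apply/rowP => j; rewrite vec_set_tnth !mxE tnth_mktuple eqxx /= eq_sym.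
by case: (i == j); rewrite ?mulr1// mulr0 add0r.
Qed.

Lemma measurable_set_tnth w i : measurable_fun setT (fun s : Rm => set_tnth w i s).
Proof.
apply/measurable_fun_tnthP => j.
rewrite (_ : _ \o _ = fun s => if j == i then s else tnth w j).
  by case: (j == i).
by apply/funext => s; rewrite /= tnth_mktuple.
Qed.

Lemma line_quotientE f w i (s : R) :
  (fun h : R => h^-1 *: (f (vec (set_tnth w i (h *: (1:R) + s))) - f (vec (set_tnth w i s)))) =
  (fun h => h^-1 *: (f (h *: 'e_i + vec (set_tnth w i s)) - f (vec (set_tnth w i s)))).
Proof. by apply/funext => h; rewrite vec_set_tnth_shift [_ *: 1]mulr1. Qed.

Lemma is_derive_line f w i (s : R) : derivable f (vec (set_tnth w i s)) 'e_i ->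
  is_derive s 1 (fun s => f (vec (set_tnth w i s))) (partial i f (vec (set_tnth w i s))).
Proof.
move=> df; have E := line_quotientE f w i s.
apply: DeriveDef; first by rewrite /derivable [X in cvg (X @ _)]E.
by rewrite /partial /derive [X in lim (X @ _)]E.
Qed.

Definition dquot f i (k : nat) (x : 'rV[R]_n) : R :=
  k.+1%:R * (f (x + k.+1%:R^-1 *: 'e_i) - f x).

Lemma enorm_delta i : enorm ('e_i : 'rV[R]_n) = 1.
Proof.
rewrite /enorm /dot (bigD1 i)//= !mxE !eqxx mul1r big1 ?addr0 ?sqrtr1// => j ji.
by rewrite mxE (negbTE ji) andbF mul0r.
Qed.

Lemma dquot_le f i k x L : (forall x y, `|f x - f y| <= L * enorm (x - y)) ->
  `|dquot f i k x| <= L.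
Proof.
move=> fL; rewrite normrM ger0_norm// -ler_pdivlMl// mulrC.
by rewrite (le_trans (fL _ _))// addrAC subrr add0r enormZ enorm_delta mulr1 ger0_norm// invr_ge0.
Qed.

(** An upper limit rather than a limit, in order to have a bounded Borel
    function defined everywhere that is the partial derivative wherever the
    latter exists. *)
Definition limsup_partial f i (x : 'rV[R]_n) : R := limn_sup (dquot f i ^~ x).

Lemma limsup_partial_le f i x L : (forall x y, `|f x - f y| <= L * enorm (x - y)) ->
  `|limsup_partial f i x| <= L.
Proof.
move=> fL; have dL k := dquot_le i k x fL.
have L0 : 0 <= L by exact: le_trans (dL 0%N).
have ub m : ubound (sdrop (dquot f i ^~ x) m) L.
  by move=> _ [k _ <-]; exact: le_trans (ler_norm _) (dL k).
have ne m : sdrop (dquot f i ^~ x) m !=set0 by exists (dquot f i m x); exists m => //=.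
have h m : - L <= sups (dquot f i ^~ x) m <= L.
  apply/andP; split; last by apply: sup_le_ub => //; exact: ub.
  apply: (@le_trans _ _ (dquot f i m x)).
    by have := dL m; rewrite ler_norml => /andP[].
  by apply: ub_le_sup; [exists L; exact: ub|exists m => //=].
rewrite /limsup_partial limn_supE; last first.
  exists L; split; first exact: num_real.
  by move=> M LM k _; exact: le_trans (dL k) (ltW LM).
rewrite ler_norml; apply/andP; split.
  apply: lb_le_inf; first by exists (sups (dquot f i ^~ x) 0%N); exists 0%N.
  by move=> _ [m _ <-]; have /andP[] := h m.
have /andP[_] := h 0%N; apply: le_trans; apply: ge_inf; last by exists 0%N.
by exists (- L) => _ [m _ <-]; have /andP[] := h m.
Qed.

Lemma measurable_limsup_partial f i L : (forall x y, `|f x - f y| <= L * enorm (x - y)) ->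
  measurable_fun setT (fun w : n.-tuple Rm => limsup_partial f i (vec w) : R).
Proof.
move=> fL.
apply: (@measurable_fun_limn_sup _ _ _ _ (fun k w => dquot f i k (vec w))).
- move=> w _; exists L => _ [k _ <-].
  exact: le_trans (ler_norm _) (dquot_le i k _ fL).
- move=> w _; exists (- L) => _ [k _ <-].
  by have := dquot_le i k (vec w) fL; rewrite ler_norml => /andP[].
- move=> k; apply: (@measurable_vec_continuous _ _ (dquot f i k)).
  apply: (@lipschitz_continuous _ _ _ (k.+1%:R * (L + L))) => x y.
  rewrite /dquot -mulrBr normrM ger0_norm// -mulrA ler_wpM2l//.
  set a := k.+1%:R^-1 *: 'e_i.
  have -> : f (x + a) - f x - (f (y + a) - f y) = (f (x + a) - f (y + a)) - (f x - f y) by ring.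
  rewrite (le_trans (ler_normB _ _))// mulrDl lerD//.
  by rewrite (le_trans (fL _ _))// opprD addrACA subrr addr0.
Qed.

Lemma limsup_partial_line f w i (s : R) :
  derivable (fun s => f (vec (set_tnth w i s))) s 1 ->
  limsup_partial f i (vec (set_tnth w i s)) = 'D_1 (fun s => f (vec (set_tnth w i s))) s.
Proof.
move=> df; rewrite /limsup_partial.
set l := RHS.
have c : dquot f i ^~ (vec (set_tnth w i s)) @ \oo --> l.
  have := df; rewrite /derivable => /cvg_ex[l' hl'].
  have ll' : l = l' by apply: cvg_lim => //.
  rewrite ll'.
  have : (fun h : R => h^-1 *: (f (vec (set_tnth w i (h *: (1:R) + s))) - f (vec (set_tnth w i
      s)))) @ (0:R)^' --> l'.
    exact: hl'.
  rewrite line_quotientE => /cvgr_dnbhsP h.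
  have hu : (forall k : nat, (k.+1%:R^-1 : R) != 0) /\ (fun k => k.+1%:R^-1 : R) @ \oo --> 0.
    by split; [move=> k; rewrite invr_eq0|exact: cvg_harmonic].
  apply: cvg_trans (h _ hu); apply: near_eq_cvg; near=> k.
  by rewrite /dquot /= invrK [_ + vec _]addrC.
by have [_ ->] := cvg_limn_inf_sup c.
Unshelve. all: by end_near. Qed.

End lines.

Section w1infty_of_lipschitz.
Context (R : realType).
Notation Rm := (measurableTypeR R).

Lemma Lnorm_pinfty_le d (T : measurableType d) (mu : {measure set T -> \bar R}) (f : T ->
    \bar R) (C : R) :
  0 <= C -> (forall x, `|f x| <= C%:E)%E -> (Lnorm mu +oo f <= C%:E)%E.
Proof.
move=> C0 fC; rewrite unlock; case: ifPn => [_|_]; last by rewrite lee_fin.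
by apply/ess_supP; apply: aeW => x /=; exact: fC.
Qed.

Lemma LinftyRd_bounded n (f : 'rV[R]_n -> R) (C : R) :
  measurable_fun setT (fun w : n.-tuple Rm => f (vec w) : R) ->
  (forall x, `|f x| <= C) -> LinftyRd f.
Proof.
move=> mf fC; split.
  exists (fun w => (f (vec w))%:E); first exact/measurable_EFinP.
  exact: ae_eq_refl.
rewrite patch_setT; apply: le_lt_trans (ltry `|C|).
apply: Lnorm_pinfty_le => // w; rewrite abse_EFin lee_fin.
exact: le_trans (fC _) (ler_norm _).
Qed.

(** On each line parallel to the i-th axis this is [lipschitz_ibp]. *)
Lemma ibp_lipschitz n (u : 'rV[R]_n -> R) (L M : R) (i : 'I_n) (phi : 'rV[R]_n -> R) :
  0 < L -> (forall x y, `|u x - u y| <= L * enorm (x - y)) ->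
  (forall x, `|u x| <= M) -> test_function phi ->
  \int[lebesgue_tuple R n]_w (u (vec w) * partial i phi (vec w)) =
  - \int[lebesgue_tuple R n]_w (limsup_partial u i (vec w) * phi (vec w)).
Proof.
move=> L0 uL uM [phis].
set K := closure _ => cK.
have cphi : continuous phi by have [] := phis [::].
have dphi j x : derivable phi x 'e_j by have [_] := phis [::]; apply.
have cphi' : continuous (partial i phi) by have [] := phis [:: i].
have phi0 x : ~ K x -> phi x = 0.
  by move=> /(contra_not (@subset_closure _ _ x)) /negP; rewrite negbK => /eqP.
have phi'0 x : ~ K x -> partial i phi x = 0.
  move=> Kx; rewrite /partial -(derive_cst (0:R) x 'e_i); apply: near_eq_derive.
  have : open (~` K) by apply: closed_openC; exact: closed_closure.
  rewrite openE => /(_ x Kx); apply: filterS => y; exact: phi0.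
have [B [B0 KB]] : exists B : R, 0 < B /\ forall x, K x -> enorm x < B.
  have /compact_bounded [B [_ /(_ (`|B| + 1))]] : compact (@enorm R n @` K).
    apply: continuous_compact cK; apply: continuous_subspaceT.
    apply: (@lipschitz_continuous _ _ _ 1) => x y; rewrite mul1r ler_norml.
    have := ler_enormD (x - y) y; have := ler_enormD (y - x) x.
    by rewrite !subrK -opprB enormN => h1 h2; apply/andP; split; lra.
  have -> : B < `|B| + 1 by rewrite (le_lt_trans (ler_norm _))// ltrDl.
  move=> /(_ isT) H; exists (`|B| + 2); split; first by rewrite ltr_wpDl.
  move=> x Kx; have /= := H (enorm x) (ex_intro2 _ _ x Kx erefl).
  by rewrite ger0_norm ?enorm_ge0// => /le_lt_trans; apply; rewrite ltrD2l ltr1n.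
have KBi (x : 'rV[R]_n) j : B <= `|x 0 j| -> ~ K x.
  move=> Bx /KB; apply/negP; rewrite -leNgt.
  exact: le_trans Bx (ler_enorm_coord _ _).
have [C1 C10 phiC] := compact_supp_bounded cphi cK phi0.
have [C2 C20 phi'C] := compact_supp_bounded cphi' cK phi'0.
have M0 : 0 <= M by exact: le_trans (uM 0).
have cu : continuous u by exact: lipschitz_continuous uL.
pose b : 'rV[R]_n := const_mx B.
have bb j : (- b) 0 j <= b 0 j by rewrite !mxE (le_trans (ltW _) (ltW B0))// oppr_lt0.
(* everything below lives in the box [-B, B]^n, which contains the support K *)
have supp w : ~ box (- b) b w -> ~ K (vec w).
  move=> bw Kw; apply: bw => j; rewrite !mxE -ler_norml.
  have -> : tnth w j = vec w 0 j by rewrite mxE.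
  by rewrite leNgt; apply/negP => /ltW /KBi.
have m1 : measurable_fun setT (fun w : n.-tuple Rm => u (vec w) * partial i phi (vec w)).
  by apply: measurable_funM; exact: measurable_vec_continuous.
have m2 : measurable_fun setT (fun w : n.-tuple Rm => limsup_partial u i (vec w) * phi (vec w)).
  apply: measurable_funM; last exact: measurable_vec_continuous.
  exact: measurable_limsup_partial uL.
have b1 (x : 'rV[R]_n) : `|u x * partial i phi x| <= M * C2 by rewrite normrM ler_pM.
have b2 (x : 'rV[R]_n) : `|limsup_partial u i x * phi x| <= L * C1.
  by rewrite normrM ler_pM//; exact: limsup_partial_le.
have i1 : (lebesgue_tuple R n).-integrable setT (EFin \o (fun w => u (vec w) * partial i phi
    (vec w))).
  apply: (integrable_box bb m1) => // w /supp /phi'0 ->; exact: mulr0.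
have i2 : (lebesgue_tuple R n).-integrable setT (EFin \o (fun w => limsup_partial u i (vec w) *
    phi (vec w))).
  apply: (integrable_box bb m2) => // w /supp /phi0 ->; exact: mulr0.
apply/eqP; rewrite -subr_eq0 opprK -RintegralD//; apply/eqP.
have Bk w (s : R) : B <= `|s| -> ~ K (vec (set_tnth w i s)).
  by move=> Bs; apply: (@KBi _ i); rewrite vec_set_tnth eqxx.
apply: (@integral_lines0 _ _ i).
- exact: measurable_funD.
- move=> w.
  apply: (@integrable_bounded_supp _ Rm _ _ (`[- B, B]%classic : set Rm)
    (fun s => u (vec (set_tnth w i s)) * partial i phi (vec (set_tnth w i s)) +
      limsup_partial u i (vec (set_tnth w i s)) * phi (vec (set_tnth w i s))) (M * C2 + L * C1)).
  + exact: measurable_itv.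
  + exact: lebesgue_segment_lty.
  + exact: (measurableT_comp (measurable_funD m1 m2) (measurable_set_tnth w i)).
  + by move=> s; rewrite (le_trans (ler_normD _ _))// lerD.
  + move=> s; rewrite /= in_itv/= -ler_norml => /negP; rewrite -ltNge => /ltW Bs.
    by rewrite phi'0 ?phi0; [rewrite !mulr0 addr0|exact: Bk..].
- move=> w.
  apply: (@lipschitz_ibp _ (fun s => u (vec (set_tnth w i s))) (fun s => phi (vec (set_tnth w i
      s)))
    (fun s => partial i phi (vec (set_tnth w i s))) (fun s => limsup_partial u i (vec (set_tnth
        w i s))) L M B) => //.
  + move=> s t; rewrite (le_trans (uL _ _))//.
    have -> : vec (set_tnth w i s) - vec (set_tnth w i t) = (s - t) *: 'e_i.
      by rewrite -[s in LHS](subrK t) vec_set_tnth_shift addrK.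
    by rewrite enormZ enorm_delta mulr1.
  + by move=> s; exact: is_derive_line.
  + move=> s; apply: (@continuous_comp _ _ _ (fun s => vec (set_tnth w i s)) (partial i phi));
      last exact: cphi'.
    move=> A /nbhs_enormP[e e0 H]; apply/nbhs_ballP; exists e => //= t st; apply: H.
    have -> : vec (set_tnth w i t) - vec (set_tnth w i s) = (t - s) *: 'e_i.
      by rewrite -[t in LHS](subrK s) vec_set_tnth_shift addrK.
    by rewrite enormZ enorm_delta mulr1 distrC.
  + by move=> s /Bk -/(_ w) /phi0.
  + exact: (measurableT_comp (measurable_limsup_partial i uL) (measurable_set_tnth w i)).
  + by move=> s; exact: limsup_partial_le.
  + by move=> s; exact: limsup_partial_line.
- exact: (integrableD measurableT i1 i2).
Qed.

(** The constant n * L bounds the Euclidean norm of a vector whose n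
    coordinates are at most L. *)
Lemma W1infty_of_lipschitz n (u : 'rV[R]_n -> R) (L M : R) :
  0 < L -> (forall x y, `|u x - u y| <= L * enorm (x - y)) ->
  (forall x, `|u x| <= M) ->
  [/\ W1infty u, (Linfty_norm u <= M%:E)%E & W1infty_grad_le u (n%:R * L)].
Proof.
move=> L0 uL uM.
have M0 : 0 <= M by exact: le_trans (uM 0).
have cu : continuous u by exact: lipschitz_continuous uL.
pose G x : 'rV[R]_n := \row_i limsup_partial u i x.
have Gi x i : G x 0 i = limsup_partial u i x by rewrite mxE.
have wG : weak_gradient u G.
  move=> i; split; [|split].
  - rewrite (_ : (fun w => _) = (fun w : n.-tuple Rm => limsup_partial u i (vec w))).
      exact: measurable_limsup_partial uL.
    by apply/funext => w; exact: Gi.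
  - rewrite (_ : (fun x => _) = limsup_partial u i); last by apply/funext => x; exact: Gi.
    apply: (@LinftyRd_bounded _ _ L); first exact: measurable_limsup_partial uL.
    by move=> x; exact: limsup_partial_le.
  - move=> phi tphi; rewrite (ibp_lipschitz i L0 uL uM tphi); congr (- _).
    by apply: eq_Rintegral => w _; rewrite Gi.
split.
- split => //; last by exists G.
  by apply: (@LinftyRd_bounded _ _ M) => //; exact: measurable_vec_continuous.
- by apply: Lnorm_pinfty_le => // w; rewrite abse_EFin lee_fin.
- exists G => //; apply: Lnorm_pinfty_le.
    by rewrite mulr_ge0// ltW.
  move=> w; rewrite abse_EFin lee_fin ger0_norm ?enorm_ge0//.
  apply: enorm_le_const; first exact: ltW.
  by move=> i; rewrite Gi; exact: limsup_partial_le.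
Qed.

End w1infty_of_lipschitz.

(** * Smooth bumps *)

Section smooth.
Context (R : realType).
Implicit Types (f g : R -> R).

(** Quantifying over the derivative instead of computing it makes closure under
    products a plain induction. *)
Fixpoint smoothn n f : Prop :=
  if n is n'.+1 then
    exists2 f', (forall x : R, is_derive x 1 f (f' x)) & smoothn n' f'
  else True.

Definition smooth f := forall n, smoothn n f.

Lemma is_derive_fun f f' : (forall x : R, is_derive x 1 f (f' x)) -> f' = f^`()%classic.
Proof.
move=> df; apply/funext => x; rewrite derive1E.
by rewrite (@derive_val _ _ _ _ _ _ _ (df x)).
Qed.

Lemma smoothnS n f : smoothn n.+1 f -> smoothn n f.
Proof.
elim: n f => [//|n IH] f [f' df sf]; exists f' => //; exact: IH.
Qed.

Lemma smooth_derive f : smooth f ->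
  (forall x : R, is_derive x 1 f (f^`()%classic x)) /\ smooth (f^`()%classic).
Proof.
move=> sf; have [f' df _] := sf 1%N.
rewrite -(is_derive_fun df); split => // n; have [f'' df'' s] := sf n.+1.
by rewrite (is_derive_fun df) -(is_derive_fun df'').
Qed.

Lemma smooth_is_derive f f' : (forall x : R, is_derive x 1 f (f' x)) ->
  smooth f' -> smooth f.
Proof. by move=> df sf' [//|n]; exists f'. Qed.

Lemma smooth_continuous f : smooth f -> continuous f.
Proof.
move=> /smooth_derive[df _] x.
apply: differentiable_continuous; apply/derivable1_diffP.
exact: (@ex_derive _ _ _ _ _ _ _ (df x)).
Qed.

Lemma smoothnD n f g : smoothn n f -> smoothn n g -> smoothn n (f + g).
Proof.
elim: n f g => [//|n IH] f g [f' df sf] [g' dg sg].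
exists (f' + g'); last exact: IH.
by move=> x; exact: is_deriveD.
Qed.

Lemma smoothnZ n f c : smoothn n f -> smoothn n (c \*: f).
Proof.
elim: n f => [//|n IH] f [f' df sf].
by exists (c \*: f'); [move=> x; exact: is_deriveZ|exact: IH].
Qed.

Lemma smoothnM n f g : smoothn n f -> smoothn n g -> smoothn n (f * g).
Proof.
elim: n f g => [//|n IH] f g sf sg.
have [f' df sf'] := sf; have [g' dg sg'] := sg.
exists (f * g' + g * f'); first by move=> x; exact: is_deriveM.
by apply: smoothnD; apply: IH => //; exact: smoothnS.
Qed.

Lemma smoothn_affine n f c b : smoothn n f -> smoothn n (fun x => f (c * x + b)).
Proof.
elim: n f => [//|n IH] f [f' df sf].
exists (c \*: (fun x => f' (c * x + b))); last by apply: smoothnZ; exact: IH.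
move=> x; have da : is_derive x 1 (fun x => c * x + b) c.
  rewrite -[c in X in is_derive _ _ _ X]addr0; apply: is_deriveD.
  rewrite -[c in X in is_derive _ _ _ X]mulr1; exact: is_deriveZ.
have := @is_derive1_comp _ f (fun x => c * x + b) x _ _ (df _) da.
by rewrite mulrC.
Qed.

(** The functions x^-m exp(-1/x), extended by 0 to x <= 0: the derivative of
    one is a linear combination of two others ([is_derive_flat]), so all of
    them are smooth, also at 0. *)
Definition flat (m : nat) (x : R) : R :=
  if 0 < x then x^-1 ^+ m * expR (- x^-1) else 0.

(** With y = 1/x, this is the bound exp y >= y^(m+2) / (m+2)!; it makes the
    function differentiable at 0 with derivative 0. *)
Lemma flat_le m x : 0 <= flat m x <= (m.+2)`!%:R * x ^+ 2.
Proof.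
rewrite /flat; case: ifPn => x0; last by rewrite lexx mulr_ge0// sqr_ge0.
have y0 : 0 < x^-1 by rewrite invr_gt0.
rewrite mulr_ge0 ?expR_ge0//=; last by rewrite exprn_ge0// ltW.
have := @expR_ge1Dxn R x^-1 m.+1 (ltW y0).
set y := x^-1 in y0 * => h.
have h2 : y ^+ m.+2 / (m.+2)`!%:R <= expR y by apply: le_trans h; rewrite lerDr.
rewrite expRN ler_pdivrMr ?expR_gt0//.
apply: (@le_trans _ _ ((m.+2)`!%:R * x ^+ 2 * (y ^+ m.+2 / (m.+2)`!%:R))); last first.
  by rewrite ler_wpM2l// mulr_ge0// sqr_ge0.
have f0 : (m.+2)`!%:R != 0 :> R by rewrite pnatr_eq0 -lt0n fact_gt0.
have xn0 : x != 0 by rewrite gt_eqF.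
rewrite le_eqVlt; apply/orP; left; apply/eqP.
rewrite !exprSr /y; move: f0; set F := _%:R; move: (_ ^+ m) => ym f0; field.
by rewrite f0 xn0.
Qed.

Lemma is_derive_flat m (x : R) :
  is_derive x 1 (flat m) (- m%:R * flat m.+1 x + flat m.+2 x).
Proof.
have [x0|x0|->] := ltgtP x 0.
- have -> : - m%:R * flat m.+1 x + flat m.+2 x = 0.
    by rewrite /flat ltNge (ltW x0)/= mulr0 addr0.
  have h0 : is_derive x (1:R) (cst (0:R)) 0 by exact: is_derive_cst.
  apply: near_eq_is_derive h0.
  near=> y; rewrite /flat ltNge (_ : y <= 0)//.
  by apply/ltW; near: y; apply: lt_nbhsl.
- have xn0 : x != 0 by rewrite gt_eqF.
  have dV : is_derive x 1 (fun x : R => x^-1) (- x ^- 2 *: 1).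
    exact: (is_deriveV xn0 (is_derive_id x 1)).
  have dX := @is_deriveX _ _ _ m _ _ _ dV.
  have dN := @is_deriveN _ _ _ _ _ _ _ dV.
  have dE := @is_derive1_comp _ expR _ x _ _ (is_derive_expR _) dN.
  have := is_deriveM dX dE.
  rewrite (_ : _ * (expR \o _) = (fun x => x^-1 ^+ m * expR (- x^-1))); last first.
    by apply/funext => y; rewrite /= exprfctE.
  move=> h; suff : is_derive x 1 (fun x => x^-1 ^+ m * expR (- x^-1)) (- m%:R * flat m.+1 x +
      flat m.+2 x).
    apply: near_eq_is_derive; near=> y; rewrite /flat (_ : 0 < y)//.
    by near: y; apply: lt_nbhsr.
  apply: is_derive_eq h _.
  rewrite /flat x0 exprfctE /=.
  rewrite /GRing.scale/= -exprVn.
  case: m dX dE => [|m] _ _.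
    by rewrite !expr0 !mulr1; ring.
  by rewrite /= !exprSr; ring.
- have -> : - m%:R * flat m.+1 0 + flat m.+2 0 = 0.
    by rewrite /flat ltxx mulr0 addr0.
  have c : (fun h : R => h^-1 *: (flat m (h *: (1:R) + 0) - flat m 0)) @ (0:R)^' --> (0:R).
    apply/cvgrPdist_le => e e0; near=> h.
    have h0 : h != 0 by near: h; exact: nbhs_dnbhs_neq.
    rewrite sub0r normrN addr0 [_ *: 1]mulr1 [flat m 0]/flat ltxx subr0 normrM.
    have /andP[f1 f2] := flat_le m h.
    rewrite (ger0_norm f1) normfV ler_pdivrMl ?normr_gt0//.
    rewrite (le_trans f2)// -[h ^+ 2]real_normK ?num_real// expr2 mulrA mulrC ler_wpM2l//.
    rewrite -ler_pdivlMl ?ltr0n ?fact_gt0//.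
    near: h; apply: dnbhs0_le; rewrite mulr_gt0// invr_gt0 ltr0n fact_gt0//.
  apply: DeriveDef; first by apply/cvg_ex; exists 0; exact: c.
  exact: (cvg_lim _ c).
Unshelve. all: by end_near. Qed.

Notation mu := (@lebesgue_measure R).

Lemma smoothn_flat n m : smoothn n (flat m).
Proof.
elim: n m => [//|n IH] m; exists ((- m%:R) \*: flat m.+1 + flat m.+2).
  by move=> x; exact: is_derive_flat.
by apply: smoothnD; [apply: smoothnZ|]; exact: IH.
Qed.

Lemma flat0_le1 x : 0 <= flat 0 x <= 1.
Proof.
have /andP[-> _] /= := flat_le 0 x.
rewrite /flat; case: ifPn => x0 //; rewrite expr0 mul1r -expR0 ler_expR.
by rewrite oppr_le0 invr_ge0 ltW.
Qed.

Lemma flat0_ge x y : 0 < x -> x <= y -> expR (- x^-1) <= flat 0 y.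
Proof.
move=> x0 xy; have y0 := lt_le_trans x0 xy.
by rewrite /flat y0 expr0 mul1r ler_expR lerN2 lef_pV2.
Qed.

(** The primitive P is part of the data because differences of such primitives
    serve as smooth cut-offs in [W1infty_partial_lipschitz]. *)
Definition is_bump (l r : R) (b P : R -> R) : Prop :=
  [/\ smooth b /\ (forall x : R, is_derive x 1 P (b x)),
      forall x, 0 <= b x, forall x, ~~ (l < x < r) -> b x = 0,
      (\int[mu]_x (b x)%:E = 1)%E &
      [/\ forall x, 0 <= P x <= 1, forall x, x <= l -> P x = 0 &
          forall x, r <= x -> P x = 1]].

(** Normalize flat(x - l) * flat(r - x). *)
Lemma bump_exists (l r : R) : l < r -> exists b P, is_bump l r b P.
Proof.
move=> lr.
pose w (x : R) : R := flat 0 (1 * x + - l) * flat 0 (- 1 * x + r).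
have sw : smooth w.
  by move=> n; apply: smoothnM; apply: smoothn_affine; exact: smoothn_flat.
have w0 x : 0 <= w x.
  by rewrite mulr_ge0//; [have /andP[] := flat0_le1 (1 * x + - l)|have /andP[] :=
      flat0_le1 (-1 * x + r)].
have w1 x : `|w x| <= 1.
  rewrite ger0_norm// -[leRHS]mulr1 ler_pM//.
  - by have /andP[] := flat0_le1 (1 * x + - l).
  - by have /andP[] := flat0_le1 (- 1 * x + r).
  - by have /andP[] := flat0_le1 (1 * x + - l).
  - by have /andP[] := flat0_le1 (- 1 * x + r).
have ws x : ~~ (l < x < r) -> w x = 0.
  rewrite negb_and -!leNgt /w /flat => /orP[xl|rx].
    by rewrite ifF ?mul0r//; apply/negbTE; rewrite -leNgt; lra.
  by rewrite [X in _ * X]ifF ?mulr0//; apply/negbTE; rewrite -leNgt; lra.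
have mw : measurable_fun setT w.
  by apply: continuous_measurable_fun; exact: smooth_continuous.
have lrlty := lebesgue_segment_lty l r.
have iw : mu.-integrable setT (EFin \o w).
  apply: (@integrable_bounded_supp _ (measurableTypeR R) _ _ (`[l, r]%classic : set
      (measurableTypeR R)) w 1) => //.
  move=> x /= xlr; apply: ws; apply/negP => /andP[lx xr]; apply: xlr.
  by rewrite in_itv/= !ltW.
have wE : (\int[mu]_x (w x)%:E = (\int[mu]_x w x)%:E)%E.
  by rewrite fineK//; exact: integrable_fin_num.
set Z := \int[mu]_x w x in wE.
have Z0 : 0 < Z.
  pose del := (r - l) / 4.
  have d0 : 0 < del by rewrite /del; lra.
  (* a lower bound of w on the middle half of [l, r] shows that its integral is positive *)
  pose c := expR (- del^-1) * expR (- del^-1).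
  have c0 : 0 < c by rewrite mulr_gt0// expR_gt0.
  have ab : l + del <= r - del by rewrite /del; lra.
  rewrite -lte_fin -wE; apply: (@lt_le_trans _ _ (\int[mu]_x (c * \1_(`[l + del, r -
      del]%classic : set R) x)%:E)%E).
    under eq_integral do rewrite EFinM.
    rewrite ge0_integralZl_EFin//; last exact: ltW.
      have -> : (\int[mu]_x (\1_(`[l + del, r - del]%classic : set R) x)%:E =
          (r - del - (l + del))%:E)%E.
        transitivity (mu `[l + del, r - del]); first by rewrite integral_indic// setIT.
        rewrite lebesgue_measure_itv/= lte_fin -EFinB.
        by case: ltgtP ab => // -> _; rewrite subrr.
      by rewrite -EFinM lte_fin mulr_gt0// /del; lra.
    by apply/measurable_EFinP.
  apply: ge0_le_integral => //.
  - by move=> x _; rewrite lee_fin mulr_ge0// ltW.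
  - by apply/measurable_EFinP; apply: measurable_funM.
  - by apply/measurable_EFinP.
  move=> x _; rewrite lee_fin indicE; case: (boolP (x \in _)) => [|_]; last by rewrite mulr0.
  rewrite inE/= in_itv/= mulr1 => /andP[h1 h2].
  by rewrite ler_pM ?expR_ge0//; apply: flat0_ge => //; lra.
pose b := Z^-1 \*: w.
have sb : smooth b by move=> n; exact: smoothnZ.
have b0 x : 0 <= b x by rewrite mulr_ge0// invr_ge0 ltW.
have bs x : ~~ (l < x < r) -> b x = 0 by move=> /ws wx; rewrite /b /= wx scaler0.
have ib : mu.-integrable setT (EFin \o b).
  rewrite (_ : EFin \o b = (fun x => Z^-1%:E * (EFin \o w) x)%E) //.
  exact: integrableZl.
have mb : measurable_fun setT b.
  by apply: continuous_measurable_fun; exact: smooth_continuous.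
have b1 : (\int[mu]_x (b x)%:E = 1)%E.
  under eq_integral do rewrite /b /= EFinM.
  rewrite ge0_integralZl_EFin ?wE//.
  - by rewrite -EFinM mulVf// gt_eqF.
  - by move=> x _; rewrite lee_fin.
  - by apply/measurable_EFinP.
  - by rewrite invr_ge0 ltW.
have ibS (A : set R) : measurable A -> mu.-integrable A (EFin \o b).
  by move=> mA; exact: integrableS ib.
pose P x := \int[mu]_(t in `]-oo, x]) b t.
exists b, P; rewrite /is_bump; split => //.
- split => // x.
  have [] := @continuous_FTC1 R b -oo%O x (x + 1) _ _ _ _.
  + by rewrite ltrDl.
  + by apply: ibS.
  + by rewrite ltNyr.
  + exact: smooth_continuous.
  rewrite derive1E => dP PE; apply: DeriveDef => //.
- have PEE x : (P x)%:E = (\int[mu]_(t in `]-oo, x]) (b t)%:E)%E.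
    by rewrite /P /Rintegral fineK//; apply: integrable_fin_num => //; exact: ibS.
  split.
  + move=> x; rewrite -!lee_fin PEE integral_ge0//= => [|t _]; last by rewrite lee_fin.
    rewrite -b1; apply: ge0_subset_integral => //.
      by apply/measurable_EFinP.
    by move=> t _; rewrite lee_fin.
  + move=> x xl; apply/EFin_inj; rewrite PEE; apply: integral0_eq => t.
    rewrite /= in_itv/= => tx; rewrite bs// negb_and -leNgt (le_trans tx)//.
  + move=> x rx; apply/EFin_inj; rewrite PEE -b1 integral_mkcond; apply: eq_integral => t _.
    rewrite patchE; case: ifPn => // /negP; rewrite inE/= in_itv/= => /negP; rewrite -ltNge => xt.
    by rewrite bs// negb_and -!leNgt (le_trans rx (ltW xt)) orbT.
Qed.

Lemma bump_family (eps : R) : 0 < eps -> exists b P : R -> R -> R,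
  forall c, is_bump (c - eps) (c + eps) (b c) (P c).
Proof.
move=> eps0.
have /choice[bP HbP] : forall c : R, exists bP : (R -> R) * (R -> R),
    is_bump (c - eps) (c + eps) bP.1 bP.2.
  move=> c; have [|b [P bump]] := @bump_exists (c - eps) (c + eps); first by lra.
  by exists (b, P).
by exists (fun c => (bP c).1), (fun c => (bP c).2).
Qed.

End smooth.

(** * Functions in W^{1,oo} are bounded and Lipschitz *)

Section product_test_functions.
Context (R : realType) (n : nat).
Notation Rm := (measurableTypeR R).
Implicit Types (f g : 'I_n -> R -> R).

Definition prodf f (x : 'rV[R]_n) : R := \prod_(j < n) f j (x 0 j).

(** The i-th partial derivative of a product of functions of one coordinate is
    again such a product ([partial_prodf]), which is what makes the iterated
    derivatives of these test functions tractable. *)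
Definition dprod f (i : 'I_n) : 'I_n -> R -> R :=
  fun j => if j == i then (f i)^`()%classic else f j.

Lemma prodf_continuous f : (forall j, continuous (f j)) -> continuous (prodf f).
Proof.
move=> cf; rewrite /prodf.
suff H (r : seq 'I_n) : continuous (fun x : 'rV[R]_n => \prod_(j <- r) f j (x 0 j)) by exact: H.
elim: r => [|a r IH].
  rewrite (_ : (fun x => _) = cst 1); first exact: cst_continuous.
  by apply/funext => x; rewrite big_nil.
rewrite (_ : (fun x => _) = (fun x : 'rV[R]_n => f a (x 0 a)) \* (fun x : 'rV[R]_n => \prod_(j
    <- r) f j (x 0 j))).
  move=> x; apply: continuousM; last exact: IH.
  apply: (@continuous_comp _ _ _ (fun x : 'rV[R]_n => x 0 a) (f a)); last exact: cf.
  exact: coord_continuous.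
by apply/funext => x; rewrite big_cons.
Qed.

Lemma is_derive_prodf f i (x : 'rV[R]_n) : is_derive (x 0 i) 1 (f i) ((f i)^`()%classic (x 0
    i)) ->
  is_derive x 'e_i (prodf f) (prodf (dprod f i) x).
Proof.
move=> [df dfE].
pose c := \prod_(j < n | j != i) f j (x 0 j).
have E (h : R) : prodf f (h *: 'e_i + x) = f i (h *: (1:R) + x 0 i) * c.
  rewrite /prodf (bigD1 i)//= !mxE !eqxx /= mulr1 [_ *: 1]mulr1; congr (_ * _).
  by apply: eq_bigr => j ji; rewrite !mxE (negbTE ji) mulr0 add0r.
have E0 : prodf f x = f i (x 0 i) * c by rewrite /prodf (bigD1 i).
have -> : prodf (dprod f i) x = c * 'D_1 (f i) (x 0 i).
  rewrite /prodf (bigD1 i)//= /dprod eqxx dfE mulrC; congr (_ * _).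
  by apply: eq_bigr => j /negbTE ->.
have H : (fun h : R => h^-1 *: (prodf f (h *: 'e_i + x) - prodf f x)) @ (0:R)^' -->
    c * 'D_1 (f i) (x 0 i).
  have -> : (fun h : R => h^-1 *: (prodf f (h *: 'e_i + x) - prodf f x)) =
      (fun h : R => c * (h^-1 *: (f i (h *: (1:R) + x 0 i) - f i (x 0 i)))).
    apply/funext => h; rewrite E E0 -mulrBl /GRing.scale/=; ring.
  by apply: cvgMr; exact: df.
by apply: DeriveDef; [apply/cvg_ex; eexists; exact: H|exact: cvg_lim H].
Qed.

Lemma smooth_dprod f i : (forall j, smooth (f j)) -> forall j, smooth (dprod f i j).
Proof.
by move=> sf j; rewrite /dprod; case: eqP => // _; have [] := smooth_derive (sf i).
Qed.

Lemma partial_prodf f i : (forall j, smooth (f j)) ->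
  partial i (prodf f) = prodf (dprod f i).
Proof.
move=> sf; apply/funext => x; rewrite /partial; apply: derive_val.
by apply: is_derive_prodf; have [] := smooth_derive (sf i).
Qed.

Lemma test_function_prodf f (lo hi : 'I_n -> R) : (forall j, smooth (f j)) ->
  (forall j x, ~~ (lo j < x < hi j) -> f j x = 0) -> test_function (prodf f).
Proof.
move=> sf f0; split.
  move=> s; have [g sg ->] : exists2 g, (forall j, smooth (g j)) &
      foldr (@partial R n) (prodf f) s = prodf g.
    elim: s => [|i s [g sg IH]]; first by exists f.
    exists (dprod g i); first exact: smooth_dprod.
    by rewrite /= IH partial_prodf.
  split; first by apply: prodf_continuous => j; exact: smooth_continuous.
  move=> i x; apply: ex_derive.
  by apply: is_derive_prodf; have [] := smooth_derive (sg i).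
pose B := [set v : 'rV[R]_n | forall j, `[lo j, hi j]%classic (v 0 j)].
have cB : compact B.
  by apply: (@rV_compact _ n (fun j => `[lo j, hi j]%classic)) => j; exact: segment_compact.
apply: (subclosed_compact _ cB); first exact: closed_closure.
have /closure_id -> : closed B by apply: compact_closed => //; exact: norm_hausdorff.
apply: closureS => x /= xn0 j; rewrite /= in_itv/=.
apply: contraT => h; move: xn0; rewrite /prodf (bigD1 j)//= f0 ?mul0r ?eqxx//.
by apply: contra h => /andP[h1 h2]; rewrite !ltW.
Qed.

End product_test_functions.

Lemma integral_majorant d (T : measurableType d) (R : realType)
    (mu : {measure set T -> \bar R}) (F G : T -> R) (c : R) :
  measurable_fun setT F -> measurable_fun setT G -> (forall x, 0 <= G x) ->
  {ae mu, forall x, `|F x| <= G x} -> (\int[mu]_x (G x)%:E = c%:E)%E ->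
  mu.-integrable setT (EFin \o F) /\ `|\int[mu]_x F x| <= c.
Proof.
move=> mF mG G0 FG Gc.
have le : (\int[mu]_x `|(EFin \o F) x| <= c%:E)%E.
  rewrite -Gc; apply: ae_ge0_le_integral => //.
  - by apply: measurableT_comp => //; exact/measurable_EFinP.
  - by move=> x _; rewrite lee_fin.
  - exact/measurable_EFinP.
  - by apply: filterS FG => x h _; rewrite /= lee_fin.
have iF : mu.-integrable setT (EFin \o F).
  apply/integrableP; split; first exact/measurable_EFinP.
  exact: le_lt_trans le (ltry _).
split => //; rewrite (le_trans (le_normr_Rintegral _ iF))//.
rewrite -lee_fin /Rintegral fineK//.
by apply: integrable_fin_num => //; exact: integrable_abse iF.
Qed.

Section W1infty_lipschitz.
Context (R : realType) (n : nat).
Notation Rm := (measurableTypeR R).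
Notation mu := (@lebesgue_measure R).
Notation mun := (lebesgue_tuple R n).

(** If the whole space were a null set, the norm would be 0 by convention and
    say nothing, but then every almost everywhere statement holds. *)
Lemma LinftyRd_ae (f : 'rV[R]_n -> R) : LinftyRd f ->
  exists2 K, 0 <= K & {ae mun, forall w, `|f (vec w)| <= K}.
Proof.
move=> [_]; rewrite patch_setT unlock; case: ifPn => mu0.
  set s := ess_sup _ _ => soo.
  have h := ess_sup_ge mun (abse \o (fun w => (f (vec w))%:E)).
  exists (`|fine s|) => //; move: h; apply: filterS.
  move=> w /= h; rewrite -lee_fin (le_trans h)// -/s.
  have : s \is a fin_num by rewrite ge0_fin_numE//; apply: le_trans h; rewrite lee_fin.
  by move=> sf; rewrite -{1}(fineK sf) lee_fin ler_norm.
move=> _; exists 0 => //; exists setT; split => //.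
by apply/eqP; rewrite eq_le measure_ge0 andbT leNgt.
Qed.

Lemma measurable_prodf (f : 'I_n -> R -> R) :
  (forall j, measurable_fun setT (f j : Rm -> R)) ->
  measurable_fun setT (fun w : n.-tuple Rm => prodf f (vec w)).
Proof.
move=> mf; apply: measurable_prod => j _.
rewrite (_ : (fun w => _) = f j \o (fun w : n.-tuple Rm => tnth w j)).
  exact: (measurableT_comp (mf j) (measurable_tnth j)).
by apply/funext => w; rewrite /= mxE.
Qed.

Lemma prodf_ge0 (f : 'I_n -> R -> R) (x : 'rV[R]_n) : (forall j y, 0 <= f j y) -> 0 <= prodf f x.
Proof. by move=> f0; apply: prodr_ge0. Qed.

Lemma prodf_integral (K : R) (f : 'I_n -> R -> R) (c : 'I_n -> R) : 0 <= K ->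
  (forall j, measurable_fun setT (f j : Rm -> R)) -> (forall j x, 0 <= f j x) ->
  (forall j, (\int[mu]_x (f j x)%:E = (c j)%:E)%E) ->
  (\int[mun]_w (K * prodf f (vec w))%:E = (K * \prod_j c j)%:E)%E.
Proof.
move=> K0 mf f0 fc; under eq_integral do rewrite EFinM.
rewrite ge0_integralZl_EFin//.
- rewrite EFinM -(@integral_prod_tuple R n f c)//; congr (_ * _)%E.
  by apply: eq_integral => w _; congr EFin; apply: eq_bigr => j _; rewrite mxE.
- by move=> w _; rewrite lee_fin prodf_ge0.
- by apply/measurable_EFinP; exact: measurable_prodf.
Qed.

(** Since [prodf B] has integral 1, the difference is the integral of
    (u - u a) * prodf B, whose second factor lives where |u - u a| <= e. *)
Lemma prodf_average (u : 'rV[R]_n -> R) (a : 'rV[R]_n) (B P : 'I_n -> R -> R) (eps e : R) :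
  continuous u -> 0 <= e ->
  (forall y : 'rV[R]_n, (forall j, `|y 0 j - a 0 j| < eps) -> `|u y - u a| <= e) ->
  (forall j, is_bump (a 0 j - eps) (a 0 j + eps) (B j) (P j)) ->
  mun.-integrable setT (EFin \o (fun w => u (vec w) * prodf B (vec w))) /\
  `|\int[mun]_w (u (vec w) * prodf B (vec w)) - u a| <= e.
Proof.
move=> cu e0 uae bumpB.
have cB j : continuous (B j) by have [[sB _] _ _ _ _] := bumpB j; exact: smooth_continuous.
have B0 j x : 0 <= B j x by have [_ + _ _ _] := bumpB j; apply.
have Bs j x : ~~ (a 0 j - eps < x < a 0 j + eps) -> B j x = 0.
  by have [_ _ + _ _] := bumpB j; apply.
have B1 j : (\int[mu]_x (B j x)%:E = 1)%E by have [] := bumpB j.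
have mB j : measurable_fun setT (B j : Rm -> R) by exact: continuous_measurable_fun.
have mp := measurable_prodf mB.
have mu_ := measurable_vec_continuous cu.
have pe K : 0 <= K -> (\int[mun]_w (K * prodf B (vec w))%:E = K%:E)%E.
  by move=> K0; rewrite (@prodf_integral K B (fun=> 1))// big1// mulr1.
have p1 : (\int[mun]_w (prodf B (vec w))%:E = 1%:E)%E.
  by rewrite -(pe 1)//; apply: eq_integral => w _; rewrite mul1r.
have m3 : measurable_fun setT (fun w : n.-tuple Rm => (u (vec w) - u a) * prodf B (vec w)).
  by apply: measurable_funM => //; exact: measurable_funB.
have m4 : measurable_fun setT (fun w : n.-tuple Rm => e * prodf B (vec w)).
  exact: measurable_funM.
have ae1 : {ae mun, forall w, `|(u (vec w) - u a) * prodf B (vec w)| <= e * prodf B (vec w)}.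
  apply: aeW => w; rewrite normrM [X in _ * X]ger0_norm ?prodf_ge0//.
  have [h|] := boolP [forall j, `|vec w 0 j - a 0 j| < eps].
    by rewrite ler_wpM2r ?prodf_ge0// uae// => j; exact: (forallP h).
  rewrite negb_forall => /existsP[j hj].
  have -> : prodf B (vec w) = 0.
    rewrite /prodf (bigD1 j)//= Bs ?mul0r//.
    by apply: contra hj => /andP[h1 h2]; rewrite ltr_norml; apply/andP; split; lra.
  by rewrite !mulr0.
have [i3 b3] := integral_majorant (mu :=
    mun) m3 m4 (fun w => mulr_ge0 e0 (prodf_ge0 (vec w) B0)) ae1 (pe _ e0).
have ip : mun.-integrable setT (EFin \o (fun w => prodf B (vec w))).
  apply/integrableP; split; first exact/measurable_EFinP.
  under eq_integral do rewrite gee0_abs ?lee_fin ?prodf_ge0//.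
  by rewrite p1 ltry.
have ip' : mun.-integrable setT (EFin \o (fun w => u a * prodf B (vec w))).
  rewrite (_ : EFin \o _ = (fun w => (u a)%:E * (EFin \o (fun w => prodf B (vec w))) w)%E) //.
  exact: integrableZl.
have E : (fun w : n.-tuple Rm => u (vec w) * prodf B (vec w)) =
    (fun w => (u (vec w) - u a) * prodf B (vec w) + u a * prodf B (vec w)).
  by apply/funext => w; ring.
have Rp : \int[mun]_w prodf B (vec w) = 1 by rewrite /Rintegral p1.
rewrite E; split; first exact: (integrableD measurableT i3 ip').
by rewrite RintegralD// (RintegralZl (u a) measurableT ip) Rp mulr1 addrK.
Qed.

(** Test the weak gradient with bumps in the coordinates other than i and, in
    coordinate i, with the difference Pi of the primitives of two bumps; Pi is
    close to the indicator of [a_i, b_i]. *)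
Lemma W1infty_partial_lipschitz (u : 'rV[R]_n -> R) (G : 'rV[R]_n -> 'rV[R]_n) i :
  continuous u -> weak_gradient u G ->
  exists2 K, 0 <= K & forall a b : 'rV[R]_n,
    (forall j, j != i -> a 0 j = b 0 j) -> a 0 i < b 0 i ->
    `|u a - u b| <= K * (b 0 i - a 0 i).
Proof.
move=> cu /(_ i)[mG [/LinftyRd_ae[K K0 GK] ibp]]; exists K => // a b ab ai.
apply/ler_addgt0Pr => e' e'0.
pose e := e' / 4; have e0 : 0 < e by rewrite /e; lra.
have /cvgrPdist_le/(_ _ e0)/nbhs_coordP[ea ea0 Ha] := cu a.
have /cvgrPdist_le/(_ _ e0)/nbhs_coordP[eb eb0 Hb] := cu b.
(* eps is small enough for the averages around a and b and for the error K * eps *)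
pose eps := Num.min (Num.min ea eb) (e / (K + 1)).
have K1 : 0 < K + 1 by rewrite ltr_wpDl.
have eps0 : 0 < eps by rewrite /eps !lt_min ea0 eb0 divr_gt0.
have Keps : K * eps <= e.
  apply: (@le_trans _ _ ((K + 1) * (e / (K + 1)))); last by rewrite mulrC divfK// gt_eqF.
  by apply: ler_pM => //; [exact: ltW|rewrite lerDl|rewrite /eps ge_min lexx orbT].
have [b' [P bump]] := bump_family eps0.
pose Ba j := b' (a 0 j); pose Bb j := b' (b 0 j).
have sb' c : smooth (b' c) by have [[]] := bump c.
have cb' c : continuous (b' c) by exact: smooth_continuous.
have b'0 c x : 0 <= b' c x by have [_ + _ _ _] := bump c; apply.
have [ia ha] : mun.-integrable setT (EFin \o (fun w => u (vec w) * prodf Ba (vec w))) /\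
    `|\int[mun]_w (u (vec w) * prodf Ba (vec w)) - u a| <= e.
  apply: prodf_average (fun j => bump (a 0 j)) => //; first exact: ltW.
  move=> y ya; rewrite distrC; apply: Ha => j; apply: lt_le_trans (ya j) _.
  by rewrite /eps !ge_min lexx.
have [ib hb] : mun.-integrable setT (EFin \o (fun w => u (vec w) * prodf Bb (vec w))) /\
    `|\int[mun]_w (u (vec w) * prodf Bb (vec w)) - u b| <= e.
  apply: prodf_average (fun j => bump (b 0 j)) => //; first exact: ltW.
  move=> y yb; rewrite distrC; apply: Hb => j; apply: lt_le_trans (yb j) _.
  by rewrite /eps !ge_min lexx orbT.
pose Pi x := P (a 0 i) x - P (b 0 i) x.
have dPi (x : R) : is_derive x 1 Pi (b' (a 0 i) x - b' (b 0 i) x).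
  have [[_ d1] _ _ _ _] := bump (a 0 i); have [[_ d2] _ _ _ _] := bump (b 0 i).
  exact: is_deriveB.
have sPi : smooth Pi.
  apply: smooth_is_derive dPi _ => m.
  rewrite (_ : (fun x => _) = b' (a 0 i) + (-1) \*: b' (b 0 i)).
    by apply: smoothnD; [exact: sb'|apply: smoothnZ; exact: sb'].
  by apply/funext => x; rewrite -[RHS]/(b' (a 0 i) x + -1 * b' (b 0 i) x) mulN1r.
pose phi j := if j == i then Pi else Ba j.
have sphi j : smooth (phi j) by rewrite /phi; case: eqP => // _; exact: sb'.
have P01 c x : 0 <= P c x <= 1 by have [_ _ _ _ []] := bump c.
have Ps x : ~~ (a 0 i - eps < x < b 0 i + eps) -> Pi x = 0.
  have [_ _ _ _ [_ Pa0 Pa1]] := bump (a 0 i); have [_ _ _ _ [_ Pb0 Pb1]] := bump (b 0 i).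
  rewrite negb_and -!leNgt => /orP[xa|bx]; rewrite /Pi.
    by rewrite Pa0// Pb0 ?subrr//; lra.
  by rewrite Pa1 ?Pb1 ?subrr//; lra.
have tphi : test_function (prodf phi).
  apply: (@test_function_prodf _ _ _ (fun j => a 0 j - eps) (fun j => if j == i then b 0 i +
      eps else a 0 j + eps)) => // j x.
  rewrite /phi; case: eqP => [->|_]; first exact: Ps.
  by have [_ _ + _ _] := bump (a 0 j); apply.
have dphi x : partial i (prodf phi) x = prodf Ba x - prodf Bb x.
  rewrite partial_prodf//.
  rewrite /prodf (bigD1 i)//= [X in _ = X - _](bigD1 i)//= [X in _ = _ - X](bigD1 i)//=.
  have -> : \prod_(j < n | j != i) Bb j (x 0 j) = \prod_(j < n | j != i) Ba j (x 0 j).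
    by apply: eq_bigr => j ji; rewrite /Bb /Ba ab.
  have -> : \prod_(j < n | j != i) dprod phi i j (x 0 j) = \prod_(j < n | j != i) Ba j (x 0 j).
    by apply: eq_bigr => j ji; rewrite /dprod /phi (negbTE ji).
  by rewrite -mulrBl /dprod /phi eqxx -(is_derive_fun dPi).
have mb' c : measurable_fun setT (b' c : Rm -> R).
  by apply: continuous_measurable_fun; exact: cb'.
(* prodf g dominates |prodf phi|: |Pi| <= 1, and Pi = 0 off [a_i - eps, b_i + eps] *)
pose g j := if j == i then \1_(`[a 0 i - eps, b 0 i + eps]%classic : set R) else Ba j.
have mg j : measurable_fun setT (g j : Rm -> R).
  rewrite /g; case: eqP => _; last exact: mb'.
  by apply: (@measurable_indic _ Rm); exact: measurable_itv.
have g0 j x : 0 <= g j x.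
  by rewrite /g; case: eqP => _; [rewrite indicE ler0n|exact: b'0].
pose c j := if j == i then b 0 i + eps - (a 0 i - eps) else 1.
have gc j : (\int[mu]_x (g j x)%:E = (c j)%:E)%E.
  rewrite /g /c; case: eqP => _; last by have [] := bump (a 0 j).
  by apply: integral_indic_itv; lra.
have gI : (\int[mun]_w (K * prodf g (vec w))%:E = (K * (b 0 i + eps - (a 0 i - eps)))%:E)%E.
  rewrite (@prodf_integral K g c)// (bigD1 i)//= big1 ?mulr1 /c ?eqxx//.
  by move=> j /negbTE ->.
have mphi : measurable_fun setT (fun w : n.-tuple Rm => prodf phi (vec w)).
  by apply: measurable_prodf => j; apply: continuous_measurable_fun; exact: smooth_continuous.
have ae1 : {ae mun, forall w, `|G (vec w) 0 i * prodf phi (vec w)| <= K * prodf g (vec w)}.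
  move: GK; apply: filterS.
  move=> w hw; rewrite normrM ler_pM// /prodf normr_prod.
  apply: ler_prod => j _; rewrite normr_ge0/=.
  rewrite /phi /g; case: eqP => [->|_]; last first.
    by rewrite ger0_norm//; exact: b'0.
  rewrite indicE; case: (boolP (_ \in _)) => [_|].
    have := P01 (a 0 i) (vec w 0 i); have := P01 (b 0 i) (vec w 0 i).
    by rewrite /Pi ler_norml => /andP[? ?] /andP[? ?]; apply/andP; split; rewrite ?mulr1n; lra.
  rewrite notin_setE/= in_itv/= => h; rewrite Ps ?normr0//.
  by apply/negP => /andP[h1 h2]; apply: h; rewrite !ltW.
have [_ hG] := integral_majorant (mu := mun)
  (F := fun w => G (vec w) 0 i * prodf phi (vec w)) (G := fun w => K * prodf g (vec w))
  (measurable_funM mG mphi) (measurable_funM (measurable_cst K) (measurable_prodf mg))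
  (fun w => mulr_ge0 K0 (prodf_ge0 (vec w) g0)) ae1 gI.
have := ibp _ tphi.
have -> : \int[mun]_w (u (vec w) * partial i (prodf phi) (vec w)) =
   \int[mun]_w (u (vec w) * prodf Ba (vec w)) - \int[mun]_w (u (vec w) * prodf Bb (vec w)).
  rewrite -RintegralB//; apply: eq_Rintegral => w _.
  by rewrite dphi mulrBr.
move: ha hb hG; set x := Rintegral _ _ _; set y := Rintegral _ _ _; set z := Rintegral _ _ _.
move=> ha hb hG xyz.
have xy : `|x - y| <= K * (b 0 i + eps - (a 0 i - eps)) by rewrite xyz normrN.
have -> : u a - u b = (x - y) - (x - u a) + (y - u b) by ring.
rewrite (le_trans (ler_normD _ _))// (le_trans (lerD (ler_normB _ _) hb))//.
have : K * (b 0 i + eps - (a 0 i - eps)) = K * (b 0 i - a 0 i) + 2 * (K * eps) by ring.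
by move=> E; move: xy ha; rewrite E /e in Keps *; lra.
Qed.

Lemma W1infty_bounded (u : 'rV[R]_n -> R) :
  continuous u -> LinftyRd u -> exists M, forall x, `|u x| <= M.
Proof.
move=> cu /LinftyRd_ae[K K0 uK]; exists K => a.
apply/ler_addgt0Pr => e e0.
have /cvgrPdist_le/(_ _ e0)/nbhs_coordP[eps eps0 Ha] := cu a.
have [b [P bump]] := bump_family eps0.
pose B j := b (a 0 j).
have mB j : measurable_fun setT (B j : Rm -> R).
  by apply: continuous_measurable_fun; have [[s _] _ _ _ _] := bump (a 0 j);
      exact: smooth_continuous.
have B0 j x : 0 <= B j x by have [_ + _ _ _] := bump (a 0 j); apply.
have [_ ha] : mun.-integrable setT (EFin \o (fun w => u (vec w) * prodf B (vec w))) /\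
    `|\int[mun]_w (u (vec w) * prodf B (vec w)) - u a| <= e.
  apply: prodf_average (fun j => bump (a 0 j)) => //; first exact: ltW.
  by move=> y ya; rewrite distrC; apply: Ha.
have gI : (\int[mun]_w (K * prodf B (vec w))%:E = K%:E)%E.
  rewrite (@prodf_integral K B (fun=> 1))// ?big1 ?mulr1// => j.
  by have [] := bump (a 0 j).
have ae1 : {ae mun, forall w, `|u (vec w) * prodf B (vec w)| <= K * prodf B (vec w)}.
  by apply: filterS uK => w uw; rewrite normrM [X in _ * X]ger0_norm ?prodf_ge0//
      ler_wpM2r ?prodf_ge0.
have [_ h] := integral_majorant (mu := mun)
  (measurable_funM (measurable_vec_continuous cu) (measurable_prodf mB))
  (measurable_funM (measurable_cst K) (measurable_prodf mB))
  (fun w => mulr_ge0 K0 (prodf_ge0 (vec w) B0)) ae1 gI.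
move: ha h; set x := Rintegral _ _ _ => ha h.
rewrite (_ : u a = x - (x - u a)); last by ring.
by rewrite (le_trans (ler_normB _ _))// lerD.
Qed.

(** Replace the coordinates of a by those of b one after the other. *)
Lemma coord_lipschitz (u : 'rV[R]_n -> R) (K : R) : 0 <= K ->
  (forall i (a b : 'rV[R]_n), (forall j, j != i -> a 0 j = b 0 j) ->
     `|u a - u b| <= K * `|a 0 i - b 0 i|) ->
  forall a b, `|u a - u b| <= n%:R * K * enorm (a - b).
Proof.
move=> K0 H a b.
pose c (k : nat) : 'rV[R]_n := \row_j (if (j < k)%N then b 0 j else a 0 j).
have c0 : c 0%N = a by apply/rowP => j; rewrite mxE.
have cn : c n = b by apply/rowP => j; rewrite mxE ltn_ord.
suff S k : (k <= n)%N -> `|u a - u (c k)| <= k%:R * K * enorm (a - b).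
  by rewrite -{1}cn; exact: S.
elim: k => [|k IH] kn; first by rewrite c0 subrr normr0 !mul0r.
rewrite (_ : u a - _ = (u a - u (c k)) + (u (c k) - u (c k.+1))); last by ring.
rewrite (le_trans (ler_normD _ _))// -natr1 !mulrDl mul1r lerD ?IH 1?ltnW//.
pose i := Ordinal kn.
apply: (le_trans (H i _ _ _)); last first.
- rewrite ler_wpM2l// !mxE /= ltnn ltnSn.
  by have := ler_enorm_coord (a - b) i; rewrite !mxE.
- move=> j ji; rewrite !mxE.
  have jk : val j != k by apply: contra ji => /eqP jk; apply/eqP/val_inj.
  by rewrite [(j < k.+1)%N]ltnS [(j <= k)%N]leq_eqVlt (negbTE jk).
Qed.

Lemma W1infty_lipschitz (u : 'rV[R]_n -> R) : W1infty u ->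
  exists M L, [/\ 0 < M, 0 < L, forall x, `|u x| <= M &
    forall x y, `|u x - u y| <= L * enorm (x - y)].
Proof.
move=> [cu Lu [G wG]].
have [M uM] := W1infty_bounded cu Lu.
have /choice[K HK] : forall i, exists K, 0 <= K /\ forall a b : 'rV[R]_n,
    (forall j, j != i -> a 0 j = b 0 j) -> a 0 i < b 0 i ->
    `|u a - u b| <= K * (b 0 i - a 0 i).
  by move=> i; have [K K0 h] := W1infty_partial_lipschitz i cu wG; exists K.
have S0 : 0 <= \sum_i K i by apply: sumr_ge0 => i _; have [] := HK i.
have KS i : K i <= \sum_i K i.
  by rewrite (bigD1 i)//= lerDl sumr_ge0// => j _; have [] := HK j.
have M0 : 0 <= M by exact: le_trans (uM 0).
have L0 : 0 <= n%:R * (\sum_i K i) by rewrite mulr_ge0.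
exists (M + 1), (n%:R * (\sum_i K i) + 1); split.
- by rewrite ltr_wpDl.
- by rewrite ltr_wpDl.
- by move=> x; rewrite (le_trans (uM x))// lerDl.
move=> x y; apply: (@le_trans _ _ (n%:R * (\sum_i K i) * enorm (x - y))); last first.
  by rewrite ler_wpM2r ?enorm_ge0// lerDl.
apply: coord_lipschitz => // i a b ab.
have [_ h] := HK i.
have [ai|bi|E] := ltgtP (a 0 i) (b 0 i).
- rewrite (le_trans (h _ _ ab ai))// distrC ger0_norm; last by rewrite subr_ge0 ltW.
  by rewrite ler_wpM2r// subr_ge0 ltW.
- have ba j : j != i -> b 0 j = a 0 j by move/ab.
  rewrite distrC (le_trans (h _ _ ba bi))// ger0_norm; last by rewrite subr_ge0 ltW.
  by rewrite ler_wpM2r// subr_ge0 ltW.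
- rewrite (_ : a = b) ?subrr ?normr0 ?mulr0//.
  by apply/rowP => j; have [->|/ab] := eqVneq j i.
Qed.

End W1infty_lipschitz.

(** * Convex functions *)

Section convex_duality.
Context (R : realType) (d : nat).
Implicit Types (f : 'rV[R]_d -> R) (p q xi : 'rV[R]_d).

Definition convex_fun f := forall p q (t : R), 0 <= t <= 1 ->
  f (t *: p + (1 - t) *: q) <= t * f p + (1 - t) * f q.

Lemma convex_functionP f : convex_function [set: 'rV[R]_d] f -> convex_fun f.
Proof.
move=> cf p q t /andP[t0 t1].
have := cf (Itv01 t0 t1) p q (mem_set I) (mem_set I).
by rewrite convRE.
Qed.

Lemma dot_delta q (k : 'I_d) : dot 'e_k q = q 0 k.
Proof.
rewrite /dot (bigD1 k)//= mxE !eqxx mul1r big1 ?addr0// => j jk.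
by rewrite mxE (negbTE jk) andbF mul0r.
Qed.

(** Hahn-Banach, one coordinate at a time: if s works on the span of the first
    k basis vectors, convexity says that each difference quotient of
    g q = f q - f 0 - s.q in direction - e_k lies below each one in direction
    e_k, and any number c in between extends s. *)
Lemma convex_subgradient f : convex_fun f -> exists s, forall q, f 0 + dot s q <= f q.
Proof.
move=> cf.
suff S k : (k <= d)%N -> exists s, forall q, (forall j : 'I_d, (k <= j)%N -> q 0 j = 0) ->
    f 0 + dot s q <= f q.
  have [s Hs] := S d (leqnn d).
  by exists s => q; apply: Hs => j; rewrite leqNgt ltn_ord.
elim: k => [_|k IH kd].
  exists 0 => q q0; rewrite dot0l addr0.
  by suff -> : q = 0 by []; apply/rowP => j; rewrite q0// mxE.
have [s Hs] := IH (ltnW kd).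
pose i := Ordinal kd.
pose V (y : 'rV[R]_d) := forall j : 'I_d, (k <= j)%N -> y 0 j = 0.
pose g q := f q - f 0 - dot s q.
have g0 y : V y -> 0 <= g y by move=> /Hs; rewrite /g; lra.
have cg : convex_fun g.
  move=> p q t t01; have := cf p q t t01.
  by rewrite /g dotDr !dotZr; lra.
pose A := [set a | exists2 y, V y & exists2 t, 0 < t & a = - g (y - t *: 'e_i) / t].
have AB a y' t' : A a -> V y' -> 0 < t' -> a <= g (y' + t' *: 'e_i) / t'.
  move=> [y Vy [t t0 ->]] Vy' t'0.
  have tt : 0 < t + t' by rewrite addr_gt0.
  pose th := t / (t + t').
  have th01 : 0 <= th <= 1.
    by apply/andP; split; [apply: divr_ge0; exact: ltW|rewrite ler_pdivrMr// mul1r lerDl ltW].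
  have := cg (y' + t' *: 'e_i) (y - t *: 'e_i) th th01.
  have E1 : 1 - th = t' / (t + t') by rewrite /th; field; rewrite gt_eqF.
  have -> : th *: (y' + t' *: 'e_i) + (1 - th) *: (y - t *: 'e_i) = th *: y' + (1 - th) *: y.
    rewrite E1 /th; apply/rowP => j; rewrite !mxE; field; rewrite gt_eqF//.
  have : V (th *: y' + (1 - th) *: y).
    by move=> j kj; rewrite !mxE Vy// Vy'// !mulr0 addr0.
  move=> /g0 h1 h2; have h := le_trans h1 h2.
  rewrite ler_pdivlMr// mulrAC ler_pdivrMr//.
  have : 0 <= (t + t') * (th * g (y' + t' *: 'e_i) + (1 - th) * g (y - t *: 'e_i)).
    by rewrite mulr_ge0// ltW.
  rewrite E1 /th (_ : (t + t') * _ = t * g (y' + t' *: 'e_i) + t' * g (y - t *: 'e_i)).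
    by lra.
  by field; rewrite gt_eqF.
have V0 : V 0 by move=> j _; rewrite mxE.
have A0 : A !=set0.
  by exists (- g (0 - 1 *: 'e_i) / 1), 0 => //; exists 1.
have Aub : has_ubound A.
  by exists (g (0 + 1 *: 'e_i) / 1) => a Aa; exact: AB.
pose c := sup A.
exists (s + c *: 'e_i) => q q0.
pose y := q - q 0 i *: 'e_i.
have Vy : V y.
  move=> j; rewrite leq_eqVlt => /predU1P[kj|kj].
    have -> : j = i by apply/val_inj.
    by rewrite !mxE !eqxx /= mulr1 subrr.
  have ji : (j == i) = false by apply/negP => /eqP ji; move: kj; rewrite ji /= ltnn.
  by rewrite !mxE ji andbF mulr0 subr0 q0.
rewrite dotDl dotZl dot_delta.
suff : c * q 0 i <= g q by rewrite /g; lra.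
have [qi|qi|qi] := ltgtP (q 0 i) 0.
- have t0 : 0 < - q 0 i by rewrite oppr_gt0.
  have : - g q / - q 0 i <= c.
    apply: ub_le_sup => //; exists y => //; exists (- q 0 i) => //.
    by congr (- g _ / _); rewrite /y scaleNr opprK subrK.
  by rewrite ler_pdivrMr// mulrN; lra.
- have : c <= g q / q 0 i.
    apply: sup_le_ub => // a Aa; have := AB a y (q 0 i) Aa Vy qi.
    by rewrite /y subrK.
  by rewrite ler_pdivlMr.
- rewrite qi mulr0 g0//; suff -> : q = y by [].
  by rewrite /y qi scale0r subr0.
Qed.

(** The supremum of xi.b - f b over the ball of radius L is, up to e, the value
    at xi + s of the conjugate of f, plus L|s|, for some s.  The convex function
    V q = inf_{|b|<=L} (f (q+b) - xi.(q+b)) satisfies V 0 + s.q <= V q for some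
    s; now apply this to q = p - c with c = - L s/|s|, which gives
    V 0 + s.p + L|s| <= f p - xi.p. *)
Lemma convex_ball_duality f xi (L e : R) : convex_fun f -> 0 <= L -> 0 < e ->
  (forall r, exists M, forall p, enorm p <= r -> `|f p| <= M) ->
  exists s b, enorm b <= L /\
    forall p, dot (xi + s) p - f p + L * enorm s <= dot xi b - f b + e.
Proof.
move=> cf L0 e0 fb.
pose psi p := f p - dot xi p.
have cpsi : convex_fun psi.
  move=> p q t t01; have := cf p q t t01.
  by rewrite /psi dotDr !dotZr; lra.
pose S q := [set psi (q + b) | b in [set b | enorm b <= L]].
have Sn q : S q !=set0 by exists (psi (q + 0)), 0 => //=; rewrite enorm0.
have Slb q : has_lbound (S q).
  have [M HM] := fb (enorm q + L).
  exists (- M - enorm xi * (enorm q + L)) => _ [b /= bL <-].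
  have qb : enorm (q + b) <= enorm q + L by rewrite (le_trans (ler_enormD _ _))// lerD.
  have := HM _ qb; rewrite ler_norml => /andP[h1 _].
  have h2 : dot xi (q + b) <= enorm xi * (enorm q + L).
    by rewrite (le_trans (cauchy_schwarz _ _))// ler_wpM2l// enorm_ge0.
  by rewrite /psi; lra.
pose V q := inf (S q).
have cV : convex_fun V.
  move=> p q t /andP[t0 t1]; apply/ler_addgt0Pr => r r0.
  have [_ [b1 /= b1L <-] h1] := inf_adherent r0 (conj (Sn p) (Slb p)).
  have [_ [b2 /= b2L <-] h2] := inf_adherent r0 (conj (Sn q) (Slb q)).
  have t1' : 0 <= 1 - t by rewrite subr_ge0.
  apply: (@le_trans _ _ (psi (t *: (p + b1) + (1 - t) *: (q + b2)))).
    apply: ge_inf; first exact: Slb.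
    exists (t *: b1 + (1 - t) *: b2).
      rewrite /= (le_trans (ler_enormD _ _))// !enormZ (ger0_norm t0) (ger0_norm t1').
      have := ler_wpM2l t0 b1L; have := ler_wpM2l t1' b2L; lra.
    by rewrite !scalerDr addrACA.
  rewrite (le_trans (cpsi _ _ _ _)) ?t0//.
  have := ler_wpM2l t0 (ltW h1); have := ler_wpM2l t1' (ltW h2); rewrite -/(V p) -/(V q); lra.
have [s Hs] := convex_subgradient cV.
have [_ [b /= bL <-] hb] := inf_adherent e0 (conj (Sn 0) (Slb 0)).
exists s, b; split => // p.
(* for s = 0 the convention x / 0 = 0 makes c = 0, as it should be *)
pose c := - (L / enorm s) *: s.
have [cL sc] : enorm c <= L /\ dot s c = - (L * enorm s).
  rewrite /c enormZ normrN dotZr -enorm_sqr ger0_norm ?divr_ge0 ?enorm_ge0//.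
  have [->|s0] := eqVneq (enorm s) 0; first by rewrite expr2 !mulr0 oppr0.
  by split; [rewrite divfK|field].
have h1 : V (p - c) <= psi p.
  by apply: ge_inf => //; exists c => //; rewrite subrK.
have := Hs (p - c); rewrite dotBr sc.
move: hb; rewrite add0r -/(V 0) /psi dotDl => hb h2.
by move: h1; rewrite /psi; lra.
Qed.

End convex_duality.

(** * One step of the scheme *)

Section one_step.
Context (R : realType) (d : nat) (H : 'rV[R]_d -> R -> 'rV[R]_d -> R).
Implicit Types (x y p xi : 'rV[R]_d) (v : 'rV[R]_d -> R).

Lemma legendre_ge x t xi p : ((dot xi p - H x t p)%:E <= legendre H x t xi)%E.
Proof. by apply: ereal_sup_ubound; exists p. Qed.

Lemma legendre_le x t xi (a : R) : (forall p, dot xi p - H x t p <= a) ->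
  (legendre H x t xi <= a%:E)%E.
Proof. by move=> ha; apply: ge_ereal_sup => _ [p _ <-]; rewrite lee_fin. Qed.

Lemma legendre_coercive x t xi (r M : R) : 0 <= r ->
  (forall p, enorm p <= r -> `|H x t p| <= M) ->
  ((r * enorm xi - M)%:E <= legendre H x t xi)%E.
Proof.
move=> r0 HM.
(* for xi = 0 the convention x / 0 = 0 makes p = 0 *)
pose p := (r / enorm xi) *: xi.
have [pr xp] : enorm p <= r /\ dot xi p = r * enorm xi.
  rewrite /p enormZ dotZr -enorm_sqr ger0_norm ?divr_ge0 ?enorm_ge0//.
  have [->|s0] := eqVneq (enorm xi) 0; first by rewrite expr2 !mulr0.
  by split; [rewrite divfK|field].
apply: le_trans (legendre_ge x t xi p); rewrite lee_fin xp lerB//.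
exact: le_trans (ler_norm _) (HM _ pr).
Qed.

Context (h : R) (n : nat) (h0 : 0 < h).
Let t := n%:R * h.
Let cost v := step_cost H h n (fun y => (v y)%:E).
Let next v x := ereal_inf [set cost v x xi | xi in [set: 'rV[R]_d]].

Lemma cost_ge v x xi (a : R) : (a%:E <= legendre H x t xi)%E ->
  ((v (x - h *: xi) + h * a)%:E <= cost v x xi)%E.
Proof.
move=> ha; rewrite /cost /step_cost EFinD EFinM leeD2l// lee_wpmul2l//.
by rewrite lee_fin ltW.
Qed.

Lemma cost_le v x xi (a : R) : (legendre H x t xi <= a%:E)%E ->
  (cost v x xi <= (v (x - h *: xi) + h * a)%:E)%E.
Proof.
move=> ha; rewrite /cost /step_cost EFinD EFinM leeD2l// lee_wpmul2l//.
by rewrite lee_fin ltW.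
Qed.

Lemma cost_leP v x xi (c : R) :
  (forall p, v (x - h *: xi) + h * (dot xi p - H x t p) <= c) ->
  (cost v x xi <= c%:E)%E.
Proof.
move=> hc.
have -> : c = v (x - h *: xi) + h * ((c - v (x - h *: xi)) / h) by field; rewrite gt_eqF.
apply: cost_le; apply: legendre_le => p.
by rewrite ler_pdivlMr// mulrC; have := hc p; lra.
Qed.

Lemma next_le v x xi c : (cost v x xi <= c)%E -> (next v x <= c)%E.
Proof. by move=> hc; apply: ge_ereal_inf; exists (cost v x xi) => //; exists xi. Qed.

Lemma next_ge v x c : (forall xi, (c <= cost v x xi)%E) -> (c <= next v x)%E.
Proof. by move=> hc; apply: le_ereal_inf_tmp => _ [xi _ <-]. Qed.

Context (Cl : R) (HCl : forall x p, - Cl <= H x t p).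

Lemma next_le_cst v x : (next v x <= (v x + h * Cl)%:E)%E.
Proof.
apply: (@next_le _ _ 0); rewrite -{2}[x]subr0 -{2}(scaler0 _ h).
apply: cost_le; apply: legendre_le => p.
by rewrite dot0l; have := HCl x p; lra.
Qed.

Lemma cost_ge_coercive v x xi (L r M : R) : 0 <= r ->
  (forall x y, `|v x - v y| <= L * enorm (x - y)) ->
  (forall p, enorm p <= r -> `|H x t p| <= M) ->
  ((v x + h * ((r - L) * enorm xi - M))%:E <= cost v x xi)%E.
Proof.
move=> r0 vL HM.
apply: le_trans (cost_ge v (legendre_coercive xi r0 HM)).
rewrite lee_fin.
have := vL x (x - h *: xi); rewrite opprB addrCA subrr addr0 enormZ (gtr0_norm h0).
rewrite ler_norml => /andP[_].
have -> : h * (r * enorm xi - M) = h * ((r - L) * enorm xi - M) + L * (h * enorm xi) by ring.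
lra.
Qed.

Lemma next_ge_cst v x (L M : R) : 0 <= L ->
  (forall x y, `|v x - v y| <= L * enorm (x - y)) ->
  (forall p, enorm p <= L -> `|H x t p| <= M) ->
  ((v x - h * M)%:E <= next v x)%E.
Proof.
move=> L0 vL HM; apply: next_ge => xi.
apply: le_trans (cost_ge_coercive xi L0 vL HM).
by rewrite subrr mul0r sub0r mulrN.
Qed.

Lemma next_ge_bound v x (B M : R) : (forall y, - B <= v y) -> `|H x t 0| <= M ->
  ((- B - h * M)%:E <= next v x)%E.
Proof.
move=> vB HM; apply: next_ge => xi.
apply: le_trans (cost_ge v (legendre_ge x t xi 0)).
rewrite lee_fin dotC dot0l sub0r mulrN; apply: lerD => //.
rewrite lerN2; apply: ler_wpM2l; first exact: ltW.
exact: le_trans (ler_norm _) HM.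
Qed.

(** In the minimization at x, replace xi by the vector xi + s of
    [convex_ball_duality]: the conjugate of H(x,t,.) at xi + s is at most
    xi.b - H(x,t,b) - L|s| up to an error, with |b| <= L, so that it can be
    compared with the conjugate at y using only the slope b, while
    v (x - h (xi + s)) exceeds v (y - h xi) by at most L|x - y| + L h|s|. *)
Lemma next_lipschitz v (L eta : R) x y :
  0 <= L -> (forall x y, `|v x - v y| <= L * enorm (x - y)) ->
  (forall x, convex_fun (H x t)) ->
  (forall x r, exists M, forall p, enorm p <= r -> `|H x t p| <= M) ->
  0 <= eta ->
  (forall p, `|H x t p - H y t p| <= eta * (1 + enorm p) * enorm (x - y)) ->
  (next v x <= next v y + ((L + h * eta * (1 + L)) * enorm (x - y))%:E)%E.
Proof.
move=> L0 vL cH bH eta0 Hxy.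
rewrite -leeBlDr//; apply: next_ge => xi; rewrite leeBlDr//.
apply/lee_addgt0Pr => e e0.
have eh0 : 0 < e / h by rewrite divr_gt0.
have [s [b [bL Hs]]] := convex_ball_duality xi (cH x) L0 eh0 (bH x).
have le1 := cost_ge v (legendre_ge y t xi b).
apply: (@le_trans _ _ ((v (y - h *: xi) + h * (dot xi b - H y t b)) +
   (L + h * eta * (1 + L)) * enorm (x - y) + e)%:E); last first.
  by rewrite !EFinD leeD2r// leeD2r// -EFinD.
have : (legendre H x t (xi + s) <= (dot xi b - H x t b + e / h - L * enorm s)%:E)%E.
  by apply: legendre_le => p; have := Hs p; lra.
move=> /(cost_le v) /next_le /le_trans; apply; rewrite lee_fin.
have h1 := vL (x - h *: (xi + s)) (y - h *: xi).
have E1 : x - h *: (xi + s) - (y - h *: xi) = (x - y) - h *: s.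
  by apply/rowP => j; rewrite !mxE; ring.
have h2 := ler_enormD (x - y) (- (h *: s)).
have h3 : L * enorm (x - h *: (xi + s) - (y - h *: xi)) <= L * enorm (x - y) + L * (h * enorm s).
  by rewrite E1 -mulrDr ler_wpM2l// (le_trans h2)// enormN enormZ gtr0_norm.
have h4 : - H x t b <= - H y t b + eta * (1 + L) * enorm (x - y).
  have := Hxy b; rewrite ler_norml => /andP[h4 _].
  have : eta * (1 + enorm b) * enorm (x - y) <= eta * (1 + L) * enorm (x - y).
    by rewrite ler_wpM2r ?enorm_ge0// ler_wpM2l// lerD2l.
  lra.
have h5 : h * (dot xi b - H x t b + e / h - L * enorm s) =
    h * (dot xi b - H x t b) + e - L * (h * enorm s) by field; rewrite gt_eqF.
have h6 := ler_wpM2l (ltW h0) h4.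
move: h1; rewrite ler_norml => /andP[_ h1].
rewrite h5; lra.
Qed.

(** The coercivity constant r = L + 1 leaves a growth h|xi| after the variation
    of v is paid for, which bounds the sublevel sets.  A minimizing sequence
    thus has a cluster point xi, and xi is a minimizer because the cost is a
    supremum over p of continuous functions of xi. *)
Lemma next_argmin v (L M c : R) x : (forall x y, `|v x - v y| <= L * enorm (x - y)) ->
  0 <= L + 1 -> (forall p, enorm p <= L + 1 -> `|H x t p| <= M) ->
  next v x = c%:E ->
  (exists xi, cost v x xi = next v x) /\
  (forall xi, cost v x xi = next v x -> enorm xi <= M + Cl).
Proof.
move=> vL L1 HM nc.
have key xi (a : R) : 0 <= a -> (cost v x xi <= (c + h * a)%:E)%E -> enorm xi <= M + Cl + a.
  move=> a0 hc; have := le_trans (cost_ge_coercive xi L1 vL HM) hc.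
  have := next_le_cst v x; rewrite nc !lee_fin addrAC subrr add0r mul1r => h1 h2.
  have : h * (enorm xi - M) <= h * (Cl + a) by rewrite mulrDr; lra.
  by rewrite ler_pM2l//; lra.
split; last first.
  move=> xi hxi; have := key xi 0 (lexx _); rewrite mulr0 !addr0; apply.
  by rewrite hxi nc.
have /choice[z Hz] : forall k : nat, exists xi, (cost v x xi <= (c + h * k.+1%:R^-1)%:E)%E.
  move=> k; have : (next v x < (c + h * k.+1%:R^-1)%:E)%E.
    by rewrite nc lte_fin ltrDl mulr_gt0// invr_gt0.
  by move=> /ereal_inf_lt[_ [xi _ <-] /ltW]; exists xi.
pose R0 := M + Cl + 1.
have zR k i : `|z k 0 i| <= R0.
  rewrite (le_trans (ler_enorm_coord _ _))// (le_trans (key _ (k.+1%:R^-1) _ (Hz k)))//.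
  by rewrite lerD2l invf_le1// ler1n.
pose B := [set q : 'rV[R]_d | forall i, `[- R0, R0]%classic (q 0 i)].
have cB : compact B.
  by apply: (@rV_compact _ d (fun=> `[- R0, R0]%classic)) => i; exact: segment_compact.
have [xi [_ cl]] : B `&` cluster (z @ \oo) !=set0.
  apply: cB; exists 0%N => // k _ i.
  by rewrite /= in_itv/= -ler_norml.
exists xi; apply/eqP; rewrite eq_le; apply/andP; split; last first.
  by apply: (@next_le v x xi).
rewrite nc; apply: cost_leP => p; apply/ler_addgt0Pr => e e0.
pose g q := v (x - h *: q) + h * (dot q p - H x t p).
have cg : continuous g.
  apply: (@lipschitz_continuous _ _ _ (`|L| * h + h * enorm p)) => q1 q2.
  rewrite /g (_ : _ - _ = (v (x - h *: q1) - v (x - h *: q2)) + h * dot (q1 - q2) p); last first.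
    by rewrite dotBl; ring.
  rewrite (le_trans (ler_normD _ _))// mulrDl lerD//.
    rewrite (le_trans (vL _ _))//.
    rewrite (_ : x - h *: q1 - (x - h *: q2) = - (h *: (q1 - q2))); last first.
      by apply/rowP => j; rewrite !mxE; ring.
    by rewrite enormN enormZ (gtr0_norm h0) mulrA ler_wpM2r ?enorm_ge0// ler_wpM2r ?ler_norm//
        ltW.
  rewrite normrM (gtr0_norm h0) -mulrA; apply: ler_wpM2l; first exact: ltW.
  rewrite ler_norml mulrC cauchy_schwarz andbT -[dot _ _]opprK lerN2 -dotNl.
  by rewrite -(enormN (q1 - q2)) cauchy_schwarz.
have e20 : 0 < e / 2 by rewrite divr_gt0.
have [K _ HK] : \forall k \near \oo, 2 * h / e < k%:R :> R by exact: nbhs_infty_gtr.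
have [q [[k /= Kk <-] hq]] : [set z k | k in [set k | (K <= k)%N]] `&` [set q | `|g xi - g q| <
    e / 2] !=set0.
  apply: cl.
    by exists K => // k Kk; exists k.
  by have /cvgrPdist_lt/(_ _ e20) := cg xi.
have h1 : g (z k) <= c + h * k.+1%:R^-1.
  by rewrite -lee_fin (le_trans (cost_ge v (legendre_ge x t (z k) p)))// Hz.
have h2 : h * k.+1%:R^-1 <= e / 2.
  have := HK k Kk => /= hk.
  rewrite ler_pdivrMr// -ler_pdivrMl//.
  have -> : (e / 2)^-1 * h = 2 * h / e by field; rewrite gt_eqF.
  by rewrite (le_trans (ltW hk))// ler_nat.
move: hq => /=; rewrite ltr_norml => /andP[_ hq].
have h3 := le_trans h1 (lerD (lexx c) h2); clear h1 h2 HK.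
have : g xi <= c + e by lra.
exact.
Qed.

End one_step.

(** * Uniform bounds along the scheme *)

Section hypotheses.
Context (R : realType) (d : nat) (T : R) (H : 'rV[R]_d -> R -> 'rV[R]_d -> R).

Lemma hypH2'_bound : hypH2' T H -> forall r, exists2 M, 0 <= M &
  forall x t p, in_time T t -> enorm p <= r -> `|H x t p| <= M.
Proof.
move=> H2 r; have r0 : 0 < `|r| + 1 by rewrite ltr_wpDl.
have [M HM] := H2 _ r0; exists `|M| => // x t p tT pr.
rewrite (le_trans (HM x t p tT _)) ?ler_norm//.
by rewrite (le_trans pr)// (le_trans (ler_norm r))// lerDl.
Qed.

(** Either growth condition makes H nonnegative for |p| large, and H is bounded
    for the other p. *)
Lemma hypH4_lower_bound : hypH2' T H -> hypH4 T H -> exists2 C, 0 <= C &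
  forall x t p, in_time T t -> - C <= H x t p.
Proof.
move=> H2 [_ H4].
have [rho Hrho] : exists rho : R, forall x t p, in_time T t -> rho < enorm p ->
    0 <= H x t p / enorm p.
  case: H4 => [[K [K0 /(_ K K0)[rho Hrho] _]]|/(_ 0)[rho Hrho]].
    exists rho => x t p tT pr; have := Hrho x t p tT pr.
    by rewrite ltr_norml => /andP[+ _]; lra.
  exists rho => x t p tT pr; rewrite -lee_fin (le_trans (Hrho p pr))//.
  by apply: ereal_inf_lbound; exists (x, t).
have [C C0 HC] := hypH2'_bound H2 (`|rho| + 1).
exists C => // x t p tT; have [pr|rp] := leP (enorm p) (`|rho| + 1).
  by have := HC x t p tT pr; rewrite ler_norml => /andP[].
have p0 : 0 < enorm p by rewrite (lt_trans _ rp)// ltr_wpDl.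
have pr : rho < enorm p by rewrite (le_lt_trans (ler_norm _))// (lt_trans _ rp)// ltrDl.
have := Hrho x t p tT pr; rewrite pmulr_lge0 ?invr_gt0// => h.
by rewrite (le_trans _ h)// oppr_le0.
Qed.

End hypotheses.

Section scheme_bounds.
Context (R : realType) (d : nat) (T : R) (H : 'rV[R]_d -> R -> 'rV[R]_d -> R)
  (u0 : 'rV[R]_d -> R).
Context (eta Cl Mz B0 L0 : R) (hT : 0 < T) (eta0 : 0 < eta) (Cl0 : 0 <= Cl)
  (Mz0 : 0 <= Mz) (L00 : 0 < L0).
Context (HCl : forall x t p, in_time T t -> - Cl <= H x t p)
  (HMz : forall x t p, in_time T t -> enorm p <= 0 -> `|H x t p| <= Mz)
  (Hb : forall r, exists2 M, 0 <= M &
    forall x t p, in_time T t -> enorm p <= r -> `|H x t p| <= M)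
  (Heta : forall t x y p, in_time T t ->
    `|H x t p - H y t p| <= eta * (1 + enorm p) * enorm (x - y))
  (Hcvx : forall x t, in_time T t -> convex_fun (H x t)).
Context (u0B : forall x, `|u0 x| <= B0)
  (u0L : forall x y, `|u0 x - u0 y| <= L0 * enorm (x - y)).
Context (N : nat) (N0 : (0 < N)%N).
Let h := T / N%:R.
Let u n x := fine (scheme H u0 h n x).
(* the solution of the recursion 1 + L_{n+1} = (1 + L_n) exp(eta h) *)
Let Ln n := (1 + L0) * expR (eta * (n%:R * h)) - 1.

Let h0 : 0 < h. Proof. by rewrite divr_gt0// ltr0n. Qed.

Lemma time_step n : (n <= N)%N -> in_time T (n%:R * h).
Proof.
move=> nN; apply/andP; split; first by apply: mulr_ge0 => //; exact: ltW.
by rewrite /h mulrCA ger_pMr// ler_pdivrMr ?ltr0n// mul1r ler_nat.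
Qed.

Lemma Ln_ge0 n : 0 <= Ln n.
Proof.
rewrite /Ln subr_ge0 -[leLHS]mulr1 ler_pM//; first by rewrite lerDl ltW.
by rewrite -expR0 ler_expR mulr_ge0// ?mulr_ge0// ltW.
Qed.

Lemma scheme_step n : (n <= N)%N ->
  (forall x, scheme H u0 h n x = (u n x)%:E) ->
  (forall x, `|u n x| <= B0 + n%:R * h * (Cl + Mz)) ->
  (forall x y, `|u n x - u n y| <= Ln n * enorm (x - y)) ->
  [/\ forall x, scheme H u0 h n.+1 x = (u n.+1 x)%:E,
      forall x, `|u n.+1 x| <= B0 + n.+1%:R * h * (Cl + Mz) &
      forall x y, `|u n.+1 x - u n.+1 y| <= Ln n.+1 * enorm (x - y)].
Proof.
move=> nN uE uB uL.
have tn := time_step nN.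
have uF : scheme H u0 h n = (fun x => (u n x)%:E) by apply/funext.
pose B := B0 + n%:R * h * (Cl + Mz).
have up x : (scheme H u0 h n.+1 x <= (u n x + h * Cl)%:E)%E.
  by rewrite /= uF; apply: next_le_cst => // y p; exact: HCl.
have lo x : ((- B - h * Mz)%:E <= scheme H u0 h n.+1 x)%E.
  rewrite /= uF; apply: next_ge_bound => // [y|].
    by have := uB y; rewrite ler_norml => /andP[].
  by apply: HMz => //; rewrite enorm0.
have uE' x : scheme H u0 h n.+1 x = (u n.+1 x)%:E.
  rewrite /u fineK// fin_numE; apply/andP; split.
    by rewrite gt_eqF// (lt_le_trans _ (lo x))// ltNyr.
  by rewrite lt_eqF// (le_lt_trans (up x))// ltry.
split => //.
- move=> x; have := up x; have := lo x; rewrite uE' !lee_fin => h1 h2.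
  have := uB x; rewrite !ler_norml => /andP[h3 h4].
  have hCl : 0 <= h * Cl by rewrite mulr_ge0// ltW.
  have hMz : 0 <= h * Mz by rewrite mulr_ge0// ltW.
  rewrite -natr1 (_ : B0 + _ = B + (h * Cl + h * Mz)); last by rewrite /B; ring.
  by rewrite -/B in h4; apply/andP; split; lra.
- suff S x y : u n.+1 x - u n.+1 y <= Ln n.+1 * enorm (x - y).
    move=> x y; rewrite ler_norml S andbT.
    by have := S y x; rewrite -(opprB x y) enormN; lra.
  have := @next_lipschitz R d H h n h0 (u n) (Ln n) eta x y (Ln_ge0 n) uL _ _ (ltW eta0) _.
  have E z : ereal_inf [set step_cost H h n (fun y => (u n y)%:E) z xi | xi in [set: 'rV_d]] =
      (u n.+1 z)%:E.
    by rewrite -uE' /= uF.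
  rewrite !E -EFinD lee_fin => /(_ _ _ _) S.
  have {}S : u n.+1 x <= u n.+1 y + (Ln n + h * eta * (1 + Ln n)) * enorm (x - y).
    apply: S.
    - by move=> z; exact: Hcvx.
    - move=> z r; have [M _ HM] := Hb r; exists M => p; exact: HM.
    - by move=> p; exact: Heta.
  rewrite lerBlDl (le_trans S)// lerD2l ler_wpM2r ?enorm_ge0//.
  have -> : Ln n.+1 = (1 + Ln n) * expR (eta * h) - 1.
    rewrite /Ln -natr1 (_ : eta * ((n%:R + 1) * h) = eta * (n%:R * h) + eta * h); last by ring.
    by rewrite expRD; ring.
  have := expR_ge1Dx (eta * h) => e1.
  have l1 : 0 <= 1 + Ln n by rewrite addr_ge0// Ln_ge0.
  have := ler_wpM2l l1 e1; lra.
Qed.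

(** The Lipschitz constant grows by a factor 1 + h eta <= exp(eta h) at each
    step (after adding 1), the sup bound by h (Cl + Mz). *)
Lemma scheme_invariant n : (n <= N)%N ->
  [/\ forall x, scheme H u0 h n x = (u n x)%:E,
      forall x, `|u n x| <= B0 + n%:R * h * (Cl + Mz) &
      forall x y, `|u n x - u n y| <= Ln n * enorm (x - y)].
Proof.
elim: n => [_|n IH nN].
  split => //.
  - by move=> x; rewrite !mul0r addr0; exact: u0B.
  - by move=> x y; rewrite /Ln mul0r mulr0 expR0 mulr1 addrAC subrr add0r; exact: u0L.
by have [] := IH (ltnW nN) => ? ? ?; apply: scheme_step => //; exact: ltnW.
Qed.

Let Lm := (1 + L0) * expR (eta * T).

Lemma Ln_le n : (n <= N)%N -> Ln n <= Lm.
Proof.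
move=> nN; rewrite /Ln /Lm lerBlDr.
apply: (@le_trans _ _ ((1 + L0) * expR (eta * T))); last by rewrite lerDl.
rewrite ler_wpM2l//; first by rewrite addr_ge0// ltW.
by rewrite ler_expR ler_wpM2l ?(ltW eta0)//; have /andP[] := time_step nN.
Qed.

Lemma scheme_lipschitz n : (n <= N)%N ->
  forall x y, `|u n x - u n y| <= Lm * enorm (x - y).
Proof.
move=> nN x y; have [_ _ uL] := scheme_invariant nN.
by rewrite (le_trans (uL x y))// ler_wpM2r ?enorm_ge0// Ln_le.
Qed.

Context (ML : R)
  (HML : forall x t p, in_time T t -> enorm p <= Lm + 1 -> `|H x t p| <= ML).

Lemma scheme_argmin n x : (n <= N)%N ->
  argmin H u0 h n x !=set0 /\
  (forall xi, argmin H u0 h n x xi -> enorm xi <= ML + Cl).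
Proof.
move=> nN; have [uE uB uL] := scheme_invariant nN.
have [uE' _ _] := scheme_step nN uE uB uL.
have tn := time_step nN.
have uF : scheme H u0 h n = (fun x => (u n x)%:E) by apply/funext.
have Lm0 : 0 <= Lm + 1 by rewrite addr_ge0// mulr_ge0 ?expR_ge0// addr_ge0// ltW.
have nE : ereal_inf [set step_cost H h n (fun y => (u n y)%:E) x xi | xi in [set: 'rV_d]] =
    (u n.+1 x)%:E.
  by rewrite -uE' /= uF.
have [] := @next_argmin R d H h n h0 Cl (fun y p => HCl y p tn) (u n) Lm ML (u n.+1 x) x
  (scheme_lipschitz nN) Lm0 (fun p => HML x tn (p:=p)) nE.
rewrite nE => -[xi hxi] hM.
have E z : argmin H u0 h n x z <-> step_cost H h n (fun y => (u n y)%:E) x z = (u n.+1 x)%:E.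
  by rewrite /argmin /= -/(scheme H u0 h n.+1) -uE' /= uF.
split; first by exists xi; apply/E.
by move=> z /E; exact: hM.
Qed.

Lemma scheme_time_step n x : (n < N)%N -> `|u n.+1 x - u n x| <= h * (Cl + ML).
Proof.
move=> nN; have nN' := ltnW nN; have [uE uB uL] := scheme_invariant nN'.
have [uE' _ _] := scheme_step nN' uE uB uL.
have tn := time_step nN'.
have uF : scheme H u0 h n = (fun x => (u n x)%:E) by apply/funext.
have nE : ereal_inf [set step_cost H h n (fun y => (u n y)%:E) x xi | xi in [set: 'rV_d]] =
    (u n.+1 x)%:E.
  by rewrite -uE' /= uF.
have Lm0 : 0 <= Lm by rewrite mulr_ge0 ?expR_ge0// addr_ge0// ltW.
have ML0 : 0 <= ML by rewrite (le_trans _ (HML 0 (p:=0) tn _))// enorm0 addr_ge0.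
have up := @next_le_cst R d H h n h0 Cl (fun y p => HCl y p tn) (u n) x.
have lo := @next_ge_cst R d H h n h0 (u n) x Lm ML Lm0 (scheme_lipschitz nN')
   (fun p hp => HML x tn (le_trans hp (ler_wpDr ler01 (lexx Lm)))).
move: up lo; rewrite nE !lee_fin => up lo.
have hCl : 0 <= h * Cl by rewrite mulr_ge0// ltW.
have hML : 0 <= h * ML by rewrite mulr_ge0// ltW.
by rewrite ler_norml mulrDr; apply/andP; split; lra.
Qed.

Lemma scheme_time_lipschitz n m x : (n <= N)%N -> (m <= N)%N ->
  `|u n x - u m x| <= (Cl + ML) * `|n%:R - m%:R| * h.
Proof.
wlog mn : n m / (m <= n)%N.
  move=> W nN mN; have [/W|/ltnW /W] := leqP m n; first exact.
  by rewrite distrC [in X in _ -> X](distrC n%:R); exact.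
move=> nN _; rewrite -(subnK mn) natrD addrK normr_nat.
have := nN; rewrite -{1}(subnK mn); elim: (n - m)%N => [_|k IH kN].
  by rewrite add0n subrr normr0 mulr0 mul0r.
rewrite (_ : u _ x - u m x = (u (k + m).+1 x - u (k + m)%N x) + (u (k + m)%N x - u m x));
    last first.
  by rewrite addSn; ring.
rewrite (le_trans (ler_normD _ _))//.
apply: le_trans (lerD (scheme_time_step x kN) (IH (ltnW kN))) _.
by rewrite -[k.+1%:R]natr1 le_eqVlt; apply/orP; left; apply/eqP; ring.
Qed.

End scheme_bounds.

Theorem lemma3p3 (R : realType) (d : nat) (hd : (0 < d)%N) (T : R) (hT : 0 < T)
  (H : 'rV[R]_d -> R -> 'rV[R]_d -> R) (u0 : 'rV[R]_d -> R)
  (hu0 : W1infty u0)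
  (hH1 : hypH1 T H) (hH2 : hypH2' T H) (hH3 : hypH3 T H) (hH4 : hypH4 T H) :
  exists C0 C1 C2 : R, [/\ 0 < C0, 0 < C1, 0 < C2 &
    forall N : nat, (0 < N)%N -> let h := T / N%:R in
    exists u : nat -> 'rV[R]_d -> R,
    [/\ forall (n : nat) (x : 'rV[R]_d), (n <= N)%N ->
          scheme H u0 h n x = (u n x)%:E,
        exists M : R, forall (n : nat) (x : 'rV[R]_d), (n <= N)%N ->
          argmin H u0 h n x !=set0 /\
          (forall xi : 'rV[R]_d, argmin H u0 h n x xi -> enorm xi <= M),
        forall n : nat, (n <= N)%N ->
          [/\ W1infty (u n),
              (Linfty_norm (u n) <= C0%:E)%E &
              W1infty_grad_le (u n) C1] &
        (forall K : R, hypH4_i T H K -> legendre_Linfty T H K) ->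
        forall (n m : nat) (x : 'rV[R]_d), (n <= N)%N -> (m <= N)%N ->
          `|u n x - u m x| <= C2 * `|n%:R - m%:R| * h]].
Proof.
have [B0 [L0 [B00 L00 u0B u0L]]] := W1infty_lipschitz hu0.
have [Cl Cl0 HCl] := hypH4_lower_bound hH2 hH4.
have [eta eta0 Heta] := hH3.
have Hb := hypH2'_bound hH2.
have [Mz Mz0 HMz] := Hb 0.
have Hcvx x t : in_time T t -> convex_fun (H x t).
  by move=> tT; apply: convex_functionP; have [c _] := hH4; exact: c.
pose Lm := (1 + L0) * expR (eta * T).
have Lm0 : 0 < Lm by rewrite mulr_gt0 ?expR_gt0// addr_gt0.
have [ML ML0 HML] := Hb (Lm + 1).
exists (B0 + T * (Cl + Mz)), (d%:R * Lm), (Cl + ML + 1); split.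
- by rewrite ltr_pwDl// mulr_ge0 ?addr_ge0// ltW.
- by rewrite mulr_gt0// ltr0n.
- by rewrite ltr_wpDl// addr_ge0.
move=> N N0 h; exists (fun n x => fine (scheme H u0 h n x)).
have inv n := scheme_invariant hT eta0 Cl0 Mz0 L00 HCl HMz Hb Heta Hcvx u0B u0L N0 (n := n).
split.
- by move=> n x nN; have [-> _ _] := inv n nN.
- exists (ML + Cl) => n x nN.
  exact: (scheme_argmin hT eta0 Cl0 Mz0 L00 HCl HMz Hb Heta Hcvx u0B u0L N0 HML).
- move=> n nN; have [_ uB _] := inv n nN.
  apply: (W1infty_of_lipschitz Lm0).
    exact: (scheme_lipschitz hT eta0 Cl0 Mz0 L00 HCl HMz Hb Heta Hcvx u0B u0L N0).
  move=> x; rewrite (le_trans (uB x))// lerD2l ler_wpM2r ?addr_ge0//.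
  by have /andP[] := time_step hT N0 nN.
- move=> _ n m x nN mN.
  apply: le_trans (scheme_time_lipschitz hT eta0 Cl0 Mz0 L00 HCl HMz Hb Heta Hcvx
    u0B u0L N0 HML x nN mN) _.
  apply: ler_wpM2r; first by apply: divr_ge0 => //; exact: ltW.
  by rewrite ler_wpM2r// lerDl.
Qed.
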